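(* Let $U\subseteq\mathbb{R}^n$ be open and $0\le k\le n$. Polyhedral $k$-chains in $U$ are dense in the Banach space of differential $k$-chains $\hat{\mathcal B}_k^r(U)$ for all integers $r\ge 1$.
   Context: Let $U\subseteq\mathbb{R}^n$ be open, fix an inner product on $\mathbb{R}^n$, and let $\Lambda_k$ be the $k$-th exterior power of $\mathbb{R}^n$. The mass of a simple $k$-vector $\alpha=v_1\wedge\cdots\wedge v_k$ is $\|\alpha\|=\sqrt{\det(\langle v_i,v_j\rangle)}$; for a general $k$-vector, $\|\alpha\|=\inf\{\sum_i\|\alpha_i\|:\alpha_i\text{ simple},\ \alpha=\sum_i\alpha_i\}$. $\mathcal A_k(U)$ (Dirac $k$-chains) is the vector space of finitely supported functions $U\to\Lambda_k$, written as finite formal sums $\sum_i(p_i;\alpha_i)$. Let $T_u(p;\alpha)=(p+u;\alpha)$, $\Delta_u=T_u-I$. For a list $\sigma^j=\{u_1,\dots,u_j\}$ of vectors put $\Delta_{\sigma^j}(p;\alpha)=\Delta_{u_j}\circ\cdots\circ\Delta_{u_1}(p;\alpha)$ and $\|\sigma^j\|=\|u_1\|\cdots\|u_j\|$; for $j=0$, $\Delta_{\emptyset}(p;\alpha)=(p;\alpha)$ and $\|\sigma^0\|=1$. $\Delta_{\sigma^j}(p;\alpha)$ is inside $U$ if the convex hull of its support is contained in $U$. For $A\in\mathcal A_k(U)$, $$\|A\|_{B^r}=\inf\Big\{\sum_i\|\sigma_i^{j(i)}\|\|\alpha_i\| : A=\sum_i\Delta_{\sigma_i^{j(i)}}(p_i;\alpha_i)\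 \text{(finite sum)},\ 0\le j(i)\le r,\ \text{each term inside }U\Big\}.$$ $\hat{\mathcal B}_k^r(U)$ is the completion of $\mathcal A_k(U)$ in this norm. For $r\le s$ the identity on Dirac chains extends to an injective continuous linking map $\hat{\mathcal B}_k^r(U)\to\hat{\mathcal B}_k^s(U)$, by which chains of class $B^r$ are regarded as chains of class $B^s$. For a linear functional $\omega$ on $\mathcal A_k(U)$ (a differential $k$-form) let $|\omega|_{B^j}=\sup\{|\omega(\Delta_{\sigma^j}(p;\alpha))| : \|\sigma^j\|\|\alpha\|=1,\ \Delta_{\sigma^j}(p;\alpha)\text{ inside }U\}$ and $\|\omega\|_{B^r}=\max_{0\le j\le r}|\omega|_{B^j}$; $\mathcal B_k^r(U)$ is the space of $\omega$ with $\|\omega\|_{B^r}<\infty$. Each such $\omega$ extends continuously to $\hat{\mathcal B}_k^r(U)$, and $\oint_J\omega:=\omega(J)$. An affine $n$-cell in $U$ is the intersection of finitely many (open or closed) affine half spaces in $U$ whose closure is compact; an affine $k$-cell in $U$ is such a cell in a $k$-dimensional affine subspace. For an oriented affine $k$-cell $\sigma$ in $U$, $\widetilde\sigma\in\hat{\mathcal B}_k^1(U)$ denotes the unique chain with $\oint_{\widetilde\sigma}\omega=\int_\sigma\omega$ (Riemann integral) for all $\omega\in\mathcal B_k^1(U)$. A polyhedral $k$-chain in $U$ is a finite sum $\sum_i a_i\widetilde{\sigma_i}$ with $a_i\in\mathbb{R}$ and $\sigma_i$ oriented affine $k$-cells in $U$. *)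

(* Defs.v *)
From HB Require Import structures.
From mathcomp Require Import all_boot all_order all_algebra.
From mathcomp Require Import sesquilinear.
From mathcomp Require Import all_classical all_reals all_analysis.

Set Implicit Arguments.
Unset Strict Implicit.
Unset Printing Implicit Defensive.

Import Order.TTheory GRing.Theory Num.Theory.
Import numFieldNormedType.Exports.

Local Open Scope classical_set_scope.
Local Open Scope quotient_scope.
Local Open Scope ring_scope.

Record seminorm (R : realType) (V : lmodType R) := Seminorm {
  seminorm_fun :> V -> R;
  seminormD : forall x y,
    seminorm_fun (x + y) <= seminorm_fun x + seminorm_fun y;
  seminormZ : forall (a : R) x, seminorm_fun (a *: x) = `|a| * seminorm_fun x
}.

Section Completion.
Variables (R : realType) (V : lmodType R) (N : seminorm V).
Implicit Types (x y : V) (u v : nat -> V).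

Lemma seminorm0 : N 0 = 0.
Proof. by rewrite -(scale0r (0 : V)) seminormZ normr0 mul0r. Qed.

Lemma seminormN x : N (- x) = N x.
Proof. by rewrite -scaleN1r seminormZ normrN1 mul1r. Qed.

Lemma seminorm_ge0 x : 0 <= N x.
Proof.
have := seminormD N x (- x); rewrite subrr seminorm0 seminormN -mulr2n.
by rewrite pmulrn_lge0.
Qed.

Lemma seminormB x y : N (x - y) <= N x + N y.
Proof. by rewrite -(seminormN y) seminormD. Qed.

Lemma seminorm_distC x y : N (x - y) = N (y - x).
Proof. by rewrite -opprB seminormN. Qed.

Lemma seminorm_distD y x z : N (x - z) <= N (x - y) + N (y - z).
Proof. by apply: le_trans (seminormD N _ _); rewrite subrKA. Qed.

Lemma seminorm_lip x y : `|N x - N y| <= N (x - y).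
Proof.
rewrite ler_norml lerBlDr lerNl opprB lerBlDr; apply/andP; split.
  rewrite seminorm_distC -{1}(subrK x y); exact: seminormD.
by rewrite -{1}(subrK y x); exact: seminormD.
Qed.

Definition is_cauchy u := forall e : R, 0 < e ->
  exists M, forall i j, (M <= i)%N -> (M <= j)%N -> N (u i - u j) < e.

Definition cauchy_seqs : {pred nat -> V} := [pred u | `[< is_cauchy u >]].

Lemma cauchy_seqs_submod : submod_closed cauchy_seqs.
Proof.
split=> [|a u v /asboolP cu /asboolP cv]; apply/asboolP => e e0.
  by exists 0%N => i j _ _; rewrite subrr seminorm0.
have a1 : 0 < `|a| + 1 by rewrite ltr_wpDl.
have e2 : 0 < e / 2 by rewrite divr_gt0.
have [M1 H1] := cu (e / 2 / (`|a| + 1)) (divr_gt0 e2 a1).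
have [M2 H2] := cv (e / 2) e2.
exists (maxn M1 M2) => i j; rewrite !geq_max => /andP[i1 i2] /andP[j1 j2].
rewrite [X in N X](_ : _ = a *: (u i - u j) + (v i - v j)); last first.
  by rewrite /= scalerBr opprD addrACA.
apply: le_lt_trans (seminormD _ _ _) _; rewrite seminormZ.
rewrite [ltRHS](splitr e) ler_ltD ?H2//.
apply: le_trans (_ : (`|a| + 1) * N (u i - u j) <= _).
  by rewrite ler_wpM2r ?seminorm_ge0// lerDl.
by rewrite mulrC -ler_pdivlMr// ltW// H1.
Qed.

HB.instance Definition _ :=
  GRing.isSubmodClosed.Build R (nat -> V) cauchy_seqs cauchy_seqs_submod.

Record cseq := CSeq { cseq_fun :> nat -> V; _ : cseq_fun \in cauchy_seqs }.

HB.instance Definition _ := [isSub for cseq_fun].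
HB.instance Definition _ := [Choice of cseq by <:].
HB.instance Definition _ := [SubChoice_isSubLmodule of cseq by <:].

Implicit Types c d : cseq.

Lemma cseqP c : is_cauchy c.
Proof. by have /asboolP := valP c. Qed.

Lemma cseq_norm_is_cvg c : cvgn (N \o c).
Proof.
apply/cauchy_cvgP/cauchy_exP => e e0.
have [M HM] := cseqP c e0; exists (N (c M)); exists M => // i /= iM.
by apply: le_lt_trans (seminorm_lip _ _) _; exact: HM.
Qed.

Definition cseq_norm c : R := limn (N \o c).

Let cseq_normD c d : cseq_norm (c + d) <= cseq_norm c + cseq_norm d.
Proof.
have cvgc := cseq_norm_is_cvg; rewrite /cseq_norm -limD//.
apply: ler_lim => //; first exact: is_cvgD.
by apply: nearW => i /=; exact: seminormD.
Qed.

Let cseq_normZ (a : R) c : cseq_norm (a *: c) = `|a| * cseq_norm c.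
Proof.
rewrite /cseq_norm (_ : N \o _ = (fun i => `|a| * (N \o c) i)).
  apply: cvg_lim => //; apply: cvgM; first exact: cvg_cst.
  exact: cseq_norm_is_cvg.
by apply/funext => i /=; exact: seminormZ.
Qed.

Definition cseq_seminorm := Seminorm cseq_normD cseq_normZ.

Definition null_cseqs : {pred cseq} := [pred c | cseq_seminorm c == 0].

End Completion.

Section Completion2.
Variables (R : realType) (V : lmodType R) (N : seminorm V).
Local Notation sn := (@cseq_seminorm R V N).

Lemma null_cseqs_zmod : zmod_closed (@null_cseqs R V N).
Proof.
split=> [|c d]; rewrite !inE; first by rewrite seminorm0.
move=> /eqP c0 /eqP d0; rewrite eq_le seminorm_ge0 andbT.
by apply: le_trans (seminormB _ _ _) _; rewrite c0 d0 addr0.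
Qed.

HB.instance Definition _ :=
  GRing.isZmodClosed.Build (cseq N) (@null_cseqs R V N) null_cseqs_zmod.

(* Cauchy sequences modulo null sequences; elements of seminorm 0 of [V] are
   sent to 0. *)
Definition completion : Type := Quotient.quot (@null_cseqs R V N).

HB.instance Definition _ := GRing.Zmodule.on completion.
HB.instance Definition _ := Quotient.on completion.

Definition completion_pi (c : cseq N) : completion := \pi c.
Local Notation pi := completion_pi.

Lemma completionP (x : completion) : exists c, x = pi c.
Proof. by exists (repr x); rewrite /completion_pi reprK. Qed.

Lemma completion_pi_eqP (c d : cseq N) : pi c = pi d <-> sn (c - d) = 0.
Proof.
rewrite /completion_pi.
have := Quotient.idealrBE (@null_cseqs R V N) c d.
rewrite !inE => E; split => [/eqP|/eqP].
  by rewrite -E => /eqP.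
by rewrite E => /eqP.
Qed.

Lemma completion_piD (c d : cseq N) : pi (c + d) = pi c + pi d.
Proof. exact: Quotient.pi_add. Qed.

Lemma completion_piN (c : cseq N) : pi (- c) = - pi c.
Proof. exact: Quotient.pi_opp. Qed.

Let repr_pi (c : cseq N) : sn (repr (pi c) - c) = 0.
Proof. by apply: (completion_pi_eqP _ _).1; rewrite /completion_pi reprK. Qed.

Definition completion_scale (a : R) (x : completion) : completion :=
  pi (a *: repr x).

Lemma completion_piZ (a : R) (c : cseq N) :
  completion_scale a (pi c) = pi (a *: c).
Proof.
by apply/completion_pi_eqP; rewrite -scalerBr seminormZ repr_pi mulr0.
Qed.

Let scaleA (a b : R) x :
  completion_scale a (completion_scale b x) = completion_scale (a * b) x.
Proof. by have [c ->] := completionP x; rewrite !completion_piZ scalerA. Qed.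

Let scale1 : left_id 1 completion_scale.
Proof.
by move=> x; have [c ->] := completionP x; rewrite completion_piZ scale1r.
Qed.

Let scaleDr : right_distributive completion_scale +%R.
Proof.
move=> a x y; have [c ->] := completionP x; have [d ->] := completionP y.
by rewrite -completion_piD !completion_piZ scalerDr completion_piD.
Qed.

Let scaleDl x : {morph completion_scale^~ x : a b / a + b}.
Proof.
move=> a b; have [c ->] := completionP x.
by rewrite !completion_piZ scalerDl completion_piD.
Qed.

HB.instance Definition _ :=
  GRing.Zmodule_isLmodule.Build R completion scaleA scale1 scaleDr scaleDl.

Definition completion_norm (x : completion) : R := sn (repr x).

Lemma completion_norm_pi (c : cseq N) : completion_norm (pi c) = sn c.
Proof.
apply/eqP; rewrite -subr_eq0 -normr_le0 -(repr_pi c).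
exact: seminorm_lip.
Qed.

Let normD x y :
  completion_norm (x + y) <= completion_norm x + completion_norm y.
Proof.
have [c ->] := completionP x; have [d ->] := completionP y.
rewrite -completion_piD !completion_norm_pi; exact: seminormD.
Qed.

Let normZ (a : R) x : completion_norm (a *: x) = `|a| * completion_norm x.
Proof.
have [c ->] := completionP x.
by rewrite [_ *: _]completion_piZ !completion_norm_pi seminormZ.
Qed.

Let norm_eq0 x : completion_norm x = 0 -> x = 0.
Proof.
have [c ->] := completionP x; rewrite completion_norm_pi => c0.
have -> : 0 = pi 0.
  by rewrite -[LHS](subrr (pi 0)) -completion_piN -completion_piD subrr.
by apply/completion_pi_eqP; rewrite subr0.
Qed.

HB.instance Definition _ :=
  Lmodule_isNormed.Build R completion normD normZ norm_eq0.

Let cst_is_cauchy (x : V) : (fun=> x) \in cauchy_seqs N.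
Proof.
by apply/asboolP => e e0; exists 0%N => i j _ _; rewrite subrr seminorm0.
Qed.

Definition completion_embed (x : V) : completion := pi (CSeq (cst_is_cauchy x)).
Local Notation emb := completion_embed.

Let emb_linear : linear emb.
Proof.
move=> a x y; rewrite /emb [a *: pi _]completion_piZ -completion_piD.
by congr pi; apply: val_inj; apply/funext.
Qed.

HB.instance Definition _ :=
  GRing.isLinear.Build R V completion *:%R completion_embed emb_linear.

Lemma completion_normE (c : cseq N) : `|pi c| = limn (N \o c).
Proof. exact: completion_norm_pi. Qed.

Lemma norm_completion_embed x : `|emb x| = N x.
Proof.
rewrite completion_normE [X in limn X](_ : _ = fun=> N x)//.
exact: (lim_cst (@Rhausdorff R)).
Qed.

Lemma cvg_completion_embed (c : cseq N) : emb (c i) @[i --> \oo] --> pi c.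
Proof.
apply/cvgrPdist_le => e e0; have [M HM] := cseqP c e0.
exists M => // m /= Mm.
rewrite -completion_piN -completion_piD completion_normE.
apply: limr_le; first exact: cseq_norm_is_cvg.
by exists M => // i /= Mi; apply/ltW/HM.
Qed.

Lemma dense_completion_embed : dense (range emb).
Proof.
move=> O [x Ox] oO; have [c xE] := completionP x.
have /(@cvg_completion_embed c)[M _ /(_ M (leqnn M)) OM] : nbhs (pi c) O.
  by rewrite -xE; exact: open_nbhs_nbhs.
by exists (emb (c M)); split => //; exists (c M).
Qed.

Let completion_complete (F : set_system completion) :
  ProperFilter F -> cauchy F -> cvg F.
Proof.
move=> FF /cauchyP cF.
have ge0 i : 0 < i.+1%:R^-1 :> R by rewrite invr_gt0.
have /choice[y yF] i : exists y, F (ball y i.+1%:R^-1) by exact: cF.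
have /choice[v vy] i : exists v, `|y i - emb v| < i.+1%:R^-1.
  have [z [/= zy [v _ vz]]] := dense_completion_embed
    (ex_intro _ (y i) (ballxx (y i) (ge0 i))) (ball_open (y i) _).
  by exists v; rewrite vz.
have vF i : F [set z | `|emb (v i) - z| < i.+1%:R^-1 *+ 2].
  apply: filterS (yF i) => z yz /=.
  by rewrite (le_lt_trans (ler_distD (y i) _ _))// mulr2n ltrD// distrC.
have small (e : R) : 0 < e ->
    exists M, forall i, (M <= i)%N -> i.+1%:R^-1 *+ 2 <= e.
  move=> e0; have e4 : 0 < e / 2 by rewrite divr_gt0.
  have [M _ HM] := near_infty_natSinv_lt (PosNum e4).
  exists M => i Mi; rewrite -[_ *+ 2]mulr_natr -ler_pdivlMr// ltW//.
  exact: (HM i Mi).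
have vC : v \in cauchy_seqs N.
  apply/asboolP => e e0; have e2 : 0 < e / 2 by rewrite divr_gt0.
  have [M HM] := small _ e2.
  exists M => i j Mi Mj.
  rewrite -norm_completion_embed raddfB/= (splitr e).
  have [z [/= zi zj]] := filter_ex (filterI (vF i) (vF j)).
  rewrite (le_lt_trans (ler_distD z _ _))// ltrD//.
    exact: lt_le_trans zi (HM _ Mi).
  by rewrite distrC; exact: lt_le_trans zj (HM _ Mj).
apply/cvg_ex; exists (pi (CSeq vC)); apply/cvgrPdist_lt => e e0.
have e2 : 0 < e / 2 by rewrite divr_gt0.
have [M HM] := small _ e2.
have /cvgrPdist_lt /(_ _ e2) [K _ HK] := @cvg_completion_embed (CSeq vC).
near=> z; have zM : `|emb (v (maxn M K)) - z| < (maxn M K).+1%:R^-1 *+ 2.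
  by near: z; exact: vF.
rewrite (splitr e) (le_lt_trans (ler_distD (emb (v (maxn M K))) _ _))// ltrD//.
  by apply: HK; rewrite /= leq_maxr.
by apply: lt_le_trans zM (HM _ _); rewrite leq_maxl.
Unshelve. all: by end_near. Qed.

HB.instance Definition _ :=
  Uniform_isComplete.Build completion completion_complete.

(* The value at [x] of the continuous extension of [f]; meaningful when [f] is
   bounded with respect to [N]. *)
Definition completion_extend (W : pnbhsType) (f : V -> W)
    (x : completion) : W :=
  lim (f v @[v --> filter_from (nbhs x) (fun O => emb @^-1` O)]).

End Completion2.

Section InfCost.
Variables (R : realType) (V : lmodType R) (cost : V -> set R).
Hypothesis cost_ge0 : forall x c, cost x c -> 0 <= c.
Hypothesis cost0 : cost 0 0.
Hypothesis costZ : forall (a : R) x c, cost x c -> cost (a *: x) (`|a| * c).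

Let lbound x : has_lbound (cost x).
Proof. by exists 0 => c; exact: cost_ge0. Qed.

Let inf_costZ_le (a : R) x : a != 0 ->
  inf (cost (a *: x)) <= `|a| * inf (cost x).
Proof.
move=> a0; have na0 : 0 < `|a| by rewrite normr_gt0.
have [xE|/set0P[c xc]] := eqVneq (cost x) set0.
  suff -> : cost (a *: x) = set0 by rewrite xE inf0 mulr0.
  apply/seteqP; split => // c /(@costZ a^-1).
  by rewrite scalerA mulVf// scale1r xE.
rewrite mulrC -ler_pdivrMr//; apply: lb_le_inf; first by exists c.
move=> d xd; rewrite ler_pdivrMr// mulrC.
by apply: ge_inf => //; exact: costZ.
Qed.

Lemma inf_costZ (a : R) x : inf (cost (a *: x)) = `|a| * inf (cost x).
Proof.
have [->|a0] := eqVneq a 0.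
  rewrite scale0r normr0 mul0r; apply/eqP; rewrite eq_le ge_inf//=.
  by apply: lb_le_inf => [|c]; [exists 0 | exact: cost_ge0].
apply/eqP; rewrite eq_le inf_costZ_le//=.
have := @inf_costZ_le a^-1 (a *: x); rewrite invr_eq0 scalerA mulVf// scale1r.
by rewrite normfV mulrC ler_pdivlMr ?normr_gt0// mulrC => ->.
Qed.

Lemma inf_costD x y :
  cost x !=set0 -> cost y !=set0 ->
  (forall c d, cost x c -> cost y d -> cost (x + y) (c + d)) ->
  inf (cost (x + y)) <= inf (cost x) + inf (cost y).
Proof.
move=> x0 y0 costD; rewrite -lerBlDr; apply: lb_le_inf => // c xc.
rewrite lerBlDr -lerBlDl; apply: lb_le_inf => // d yd.
by rewrite lerBlDl ge_inf//; exact: costD.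
Qed.

End InfCost.

(* Strictly increasing multi-indices: [kvec R n k] is the [k]-th exterior power
   of [R^n] in the basis [e_(i_1) /\ ... /\ e_(i_k)], [i_1 < ... < i_k]. *)
Definition multi_index (n k : nat) : Type :=
  {I : k.-tuple 'I_n | sorted ltn [seq val i | i <- I]}.

HB.instance Definition _ n k := Finite.on (multi_index n k).

Definition kvec (R : realType) (n k : nat) : Type :=
  {ffun multi_index n k -> R^o}.

HB.instance Definition _ R n k := GRing.Lmodule.on (kvec R n k).

Section Mass.
Variables (R : realType) (n k : nat) (ip : {dot 'rV[R]_n for idfun}).
Implicit Types (M : 'M[R]_(k, n)) (alpha : kvec R n k).

(* The wedge product of the rows of [M]: its coordinates are the maximal
   minors. *)
Definition wedge M : kvec R n k :=
  [ffun I : multi_index n k => \det (colsub (tnth (val I)) M)].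

Definition gram M : 'M[R]_k := \matrix_(i, j) ip (row i M) (row j M).

(* A pair [(c, M)] stands for the simple [k]-vector [c *: wedge M]; the scalar
   is only needed for [k = 0], where the only wedge product is [1]. *)
Definition simple_mass (t : R * 'M[R]_(k, n)) : R :=
  `|t.1| * Num.sqrt (\det (gram t.2)).

Definition mass_costs alpha : set R :=
  [set m | exists2 s : seq (R * 'M[R]_(k, n)),
    alpha = \sum_(t <- s) t.1 *: wedge t.2 & m = \sum_(t <- s) simple_mass t].

Definition mass alpha : R := inf (mass_costs alpha).

Definition ip_norm (u : 'rV[R]_n) : R := Num.sqrt (ip u u).

End Mass.

Section DiracChains.
Variables (R : realType) (n k : nat) (U : set 'rV[R]_n).
Local Notation field := ('rV[R]_n -> kvec R n k).
Implicit Types (A : field) (p u : 'rV[R]_n) (alpha : kvec R n k).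

Definition chain_supp A : set 'rV[R]_n := [set p | A p != 0].

Definition dirac_pred : {pred field} :=
  [pred A | `[< finite_set (chain_supp A) /\ chain_supp A `<=` U >]].

Lemma dirac_submod : submod_closed dirac_pred.
Proof.
split=> [|a A B /asboolP[fA AU] /asboolP[fB BU]]; apply/asboolP.
  have -> : chain_supp 0 = set0.
    by apply/seteqP; split => // p; rewrite /chain_supp/= eqxx.
  by split; [exact: finite_set0 | exact: sub0set].
have sub : chain_supp (a *: A + B) `<=` chain_supp A `|` chain_supp B.
  move=> p; rewrite /chain_supp/= => ABp.
  have [Ap|Ap] := eqVneq (A p) 0; last by left.
  right; move: ABp; rewrite [X in X != _](_ : _ = a *: A p + B p)//.
  by rewrite Ap scaler0 add0r.
split; first by apply: sub_finite_set sub _; rewrite finite_setU.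
by apply: subset_trans sub _; rewrite subUset.
Qed.

HB.instance Definition _ :=
  GRing.isSubmodClosed.Build R field dirac_pred dirac_submod.

Record dirac_chain := DiracChain {
  dirac_fun :> field ; _ : dirac_fun \in dirac_pred }.

HB.instance Definition _ := [isSub for dirac_fun].
HB.instance Definition _ := [Choice of dirac_chain by <:].
HB.instance Definition _ := [SubChoice_isSubLmodule of dirac_chain by <:].

End DiracChains.

Section DifferenceNorms.
Variables (R : realType) (n k : nat) (ip : {dot 'rV[R]_n for idfun}).
Variable (U : set 'rV[R]_n).
Local Notation field := ('rV[R]_n -> kvec R n k).
Implicit Types (A : field) (p u : 'rV[R]_n) (alpha : kvec R n k).
Implicit Types (sigma : seq 'rV[R]_n).

Definition point_chain p alpha : field := fun q => if q == p then alpha else 0.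

(* Difference chains are functions on the whole space: they are compared with
   Dirac chains in [U] only when they are inside [U]. *)
Definition translate u A : field := fun q => A (q - u).

Definition delta A u : field := translate u A - A.

Definition delta_chain sigma p alpha : field :=
  foldl delta (point_chain p alpha) sigma.

Definition list_norm sigma : R := \prod_(u <- sigma) ip_norm ip u.

Definition convex_hull (S : set 'rV[R]_n) : set 'rV[R]_n :=
  smallest (@convex_set R 'rV[R]_n) S.

Definition inside sigma p alpha : Prop :=
  convex_hull (chain_supp (delta_chain sigma p alpha)) `<=` U.

Local Notation term := (seq 'rV[R]_n * 'rV[R]_n * kvec R n k)%type.

Definition term_chain (t : term) : field := delta_chain t.1.1 t.1.2 t.2.

Definition term_cost (t : term) : R := list_norm t.1.1 * mass ip t.2.

Definition admissible (r : nat) (t : term) : Prop :=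
  (size t.1.1 <= r)%N /\ inside t.1.1 t.1.2 t.2.

Definition Bcosts (r : nat) (A : dirac_chain k U) : set R :=
  [set c | exists s : seq term,
    [/\ forall t, t \in s -> admissible r t,
        \val A = \sum_(t <- s) term_chain t
      & c = \sum_(t <- s) term_cost t]].

Definition Bnorm_fun (r : nat) (A : dirac_chain k U) : R := inf (Bcosts r A).

Implicit Types (X Y : dirac_chain k U).

Lemma mass_ge0 alpha : 0 <= mass ip alpha.
Proof.
have H : lbound (mass_costs ip alpha) 0.
  move=> _ [s _ ->]; apply: sumr_ge0 => t _.
  by rewrite mulr_ge0// sqrtr_ge0.
have [E|/set0P ne] := eqVneq (mass_costs ip alpha) set0.
  by rewrite /mass E inf0.
exact: lb_le_inf.
Qed.

Lemma massZ (a : R) alpha : mass ip (a *: alpha) = `|a| * mass ip alpha.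
Proof.
apply: (@inf_costZ R _ (mass_costs ip)) => [x _ [s _ ->]||b x _ [s -> ->]].
- by apply: sumr_ge0 => t _; rewrite mulr_ge0// sqrtr_ge0.
- by exists [::]; rewrite big_nil.
- exists [seq (b * t.1, t.2) | t <- s]; rewrite big_map.
    by rewrite scaler_sumr; apply: eq_bigr => t _; rewrite scalerA.
  rewrite mulr_sumr; apply: eq_bigr => t _.
  by rewrite /simple_mass normrM mulrA.
Qed.

Lemma delta_chainZ (a : R) sigma p alpha :
  delta_chain sigma p (a *: alpha) = a *: delta_chain sigma p alpha.
Proof.
rewrite /delta_chain (_ : point_chain p _ = a *: point_chain p alpha).
  elim: sigma (point_chain p alpha) => //= u sigma IH A; rewrite -IH.
  by congr foldl; apply/funext => q; rewrite /delta/= -scalerBr.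
apply/funext => q; rewrite [RHS](_ : _ = a *: point_chain p alpha q)//.
by rewrite /point_chain; case: ifP; rewrite ?scaler0.
Qed.

Lemma list_norm_ge0 sigma : 0 <= list_norm sigma.
Proof. by apply: prodr_ge0 => u _; exact: sqrtr_ge0. Qed.

Lemma insideZ (a : R) sigma p alpha :
  inside sigma p alpha -> inside sigma p (a *: alpha).
Proof.
apply: subset_trans => x hx C [cC sC]; apply: hx; split => //.
apply: subset_trans sC; rewrite delta_chainZ => q.
rewrite /chain_supp/= [X in X != _](_ : _ = a *: delta_chain sigma p alpha q)//.
by apply: contraNN => /eqP ->; rewrite scaler0.
Qed.

Let Bcosts_ge0 r X c : Bcosts r X c -> 0 <= c.
Proof.
move=> [s [_ _ ->]]; apply: sumr_ge0 => t _.
by rewrite mulr_ge0 ?list_norm_ge0 ?mass_ge0.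
Qed.

Let Bcosts0 r : Bcosts r 0 0.
Proof. by exists [::]; rewrite !big_nil; split. Qed.

Let BcostsZ r (a : R) X c : Bcosts r X c -> Bcosts r (a *: X) (`|a| * c).
Proof.
move=> [s [sr As ->]]; exists [seq (t.1, a *: t.2) | t <- s]; split.
- by move=> _ /mapP[t /sr[tr tin] ->]; split => //; exact: insideZ.
- rewrite /= As scaler_sumr big_map; apply: eq_bigr => t _.
  by rewrite /term_chain delta_chainZ.
- rewrite mulr_sumr big_map; apply: eq_bigr => t _.
  by rewrite /term_cost massZ mulrCA.
Qed.

Let BcostsD r X Y c d :
  Bcosts r X c -> Bcosts r Y d -> Bcosts r (X + Y) (c + d).
Proof.
move=> [s [sr As ->]] [s' [s'r Bs ->]]; exists (s ++ s'); split.
- by move=> t; rewrite mem_cat => /orP[/sr|/s'r].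
- by rewrite /= As Bs big_cat.
- by rewrite big_cat.
Qed.

Let Bcosts_neq0 r X : Bcosts r X !=set0.
Proof.
have /asboolP[/finite_seqP[/= s As] AU] := valP X.
pose ts := [seq ([::], p, val X p) | p <- undup s] : seq term.
exists (\sum_(t <- ts) term_cost t), ts; split=> //.
  move=> _ /mapP[p ps ->]; split => //=.
  have pU : U p by apply: AU; rewrite As/= -mem_undup.
  apply: subset_trans (_ : [set p] `<=` U); last by move=> _ ->.
  apply: smallest_sub.
    by move=> x y l; rewrite !inE/= => -> ->; rewrite convmm.
  move=> q; rewrite /chain_supp/= /delta_chain/= /point_chain.
  by case: (eqVneq q p) => [->|_]//; rewrite eqxx.
apply/funext => q; rewrite big_map fct_sumE.
rewrite (eq_bigr (fun p => if q == p then val X p else 0)); last by [].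
have [qs|qs] := boolP (q \in undup s).
  rewrite (bigD1_seq q) ?undup_uniq//= eqxx big1 ?addr0// => p.
  by rewrite eq_sym => /negPf ->.
rewrite big_seq big1 => [|p ps]; last first.
  by case: (eqVneq q p) => // qp; rewrite qp ps in qs.
apply/eqP; apply: contraNT qs => Aq; rewrite mem_undup.
by have : [set` s] q by rewrite -As.
Qed.

Let Bnorm_funD r X Y : Bnorm_fun r (X + Y) <= Bnorm_fun r X + Bnorm_fun r Y.
Proof.
apply: (@inf_costD R _ (@Bcosts r)) => //; first exact: Bcosts_ge0.
by move=> c d; exact: BcostsD.
Qed.

Let Bnorm_funZ r (a : R) X : Bnorm_fun r (a *: X) = `|a| * Bnorm_fun r X.
Proof.
apply: (@inf_costZ R _ (@Bcosts r)).
- exact: Bcosts_ge0.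
- exact: Bcosts0.
- exact: BcostsZ.
Qed.

Definition Bnorm r : seminorm (dirac_chain k U) :=
  Seminorm (Bnorm_funD r) (Bnorm_funZ r).

End DifferenceNorms.

Arguments Bnorm {R n} k ip U r.

Notation differential_chain k ip U r := (completion (Bnorm k ip U r)).

Section Forms.
Variables (R : realType) (n k : nat) (ip : {dot 'rV[R]_n for idfun}).
Variable (U : set 'rV[R]_n).
Implicit Types (omega : {scalar dirac_chain k U}).

Local Open Scope ereal_scope.

Definition form_seminorm (j : nat) omega : \bar R :=
  ereal_sup [set `|omega A|%:E | A in [set A : dirac_chain k U |
    exists sigma p alpha, [/\ size sigma = j,
      (list_norm ip sigma * mass ip alpha)%R = 1%R, inside U sigma p alpha
      & \val A = delta_chain sigma p alpha]]].

Definition form_norm (r : nat) omega : \bar R :=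
  \big[maxe/0]_(j < r.+1) form_seminorm j omega.

Definition Bform (r : nat) omega : Prop := form_norm r omega < +oo.

End Forms.

Definition chain_integral (R : realType) (n k : nat)
    (ip : {dot 'rV[R]_n for idfun}) (U : set 'rV[R]_n) (r : nat)
    (omega : {scalar dirac_chain k U}) (J : differential_chain k ip U r) : R :=
  completion_extend (omega : dirac_chain k U -> R) J.

(* Extends the identity of Dirac chains; meaningful for [r <= s]. *)
Definition linking_map (R : realType) (n k : nat)
    (ip : {dot 'rV[R]_n for idfun}) (U : set 'rV[R]_n) (r s : nat)
    (J : differential_chain k ip U r) : differential_chain k ip U s :=
  completion_extend (completion_embed (Bnorm k ip U s)) J.

Section Riemann.
Variables (R : realType) (k : nat).
Implicit Types (a b : 'rV[R]_k) (f : 'rV[R]_k -> R).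

(* [s i 0 <= s i 1 <= ... <= s i N] subdivides the [i]-th side of the box
   [[a, b]] into intervals of length less than [d]; points may be repeated, so
   it is harmless that the [k] sides have the same number of intervals. *)
Definition subdivision a b (d : R) (N : nat) (s : 'I_k -> nat -> R) : Prop :=
  forall i, [/\ s i 0%N = a 0 i, s i N = b 0 i
    & forall j, (j < N)%N -> 0 <= s i j.+1 - s i j < d].

(* [m] ranges over the boxes of the subdivision. *)
Definition tags (N : nat) (s : 'I_k -> nat -> R)
    (t : {ffun 'I_k -> 'I_N} -> 'rV[R]_k) : Prop :=
  forall (m : {ffun 'I_k -> 'I_N}) i, s i (m i) <= t m 0 i <= s i (m i).+1.

Definition riemann_sum (N : nat) (s : 'I_k -> nat -> R)
    (t : {ffun 'I_k -> 'I_N} -> 'rV[R]_k) f : R :=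
  \sum_(m : {ffun 'I_k -> 'I_N}) f (t m) * \prod_i (s i (m i).+1 - s i (m i)).

Definition riemann_box a b f (I : R) : Prop :=
  forall e, 0 < e -> exists2 d, 0 < d &
    forall N s t, subdivision a b d N s -> @tags N s t ->
      `|riemann_sum s t f - I| < e.

(* [f] is extended by 0 outside the bounded set [D]; the value does not depend
   on the box. *)
Definition riemann_integral (D : set 'rV[R]_k) f (I : R) : Prop :=
  exists a b, [/\ forall i, a 0 i <= b 0 i,
    D `<=` [set t | forall i, a 0 i <= t 0 i <= b 0 i]
    & riemann_box a b (fun t => if t \in D then f t else 0) I].

End Riemann.

Section Polyhedral.
Variables (R : realType) (n k : nat) (ip : {dot 'rV[R]_n for idfun}).
Variable (U : set 'rV[R]_n).
Implicit Types (o : 'rV[R]_n) (F : 'M[R]_(k, n)) (sigma : set 'rV[R]_n).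

(* A triple [(closed, a, b)] encodes the half space [<a, x> <= b] if [closed]
   and [<a, x> < b] otherwise. *)
Definition half_space (h : bool * 'rV[R]_n * R) : set 'rV[R]_n :=
  [set x | if h.1.1 then ip h.1.2 x <= h.2 else ip h.1.2 x < h.2].

Definition frame_map o F (t : 'rV[R]_k) : 'rV[R]_n := o + t *m F.

(* [sigma] is an affine [k]-cell in [U] lying in the [k]-dimensional affine
   subspace through [o] spanned by the rows of [F]; the basis [F] also orients
   this subspace, hence the cell. *)
Definition oriented_cell o F sigma : Prop :=
  [/\ row_free F,
      exists hs : seq (bool * 'rV[R]_n * R),
        (forall h, h \in hs -> h.1.2 != 0) /\
        sigma = range (frame_map o F) `&`
                [set x | forall h, h \in hs -> half_space h x],
      compact (closure sigma) & closure sigma `<=` U].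

(* 0 when [p] is not in [U]. *)
Definition dirac (p : 'rV[R]_n) (alpha : kvec R n k) : dirac_chain k U :=
  insubd 0 (point_chain p alpha).

(* [I] is the integral of [omega] over the cell [sigma], computed in the
   coordinates given by the oriented frame [(o, F)]: the pullback of [omega]
   has density [omega (x; F_1 /\ ... /\ F_k)]. *)
Definition cell_integral (omega : {scalar dirac_chain k U}) o F sigma (I : R) :=
  riemann_integral (frame_map o F @^-1` sigma)
    (fun t => omega (dirac (frame_map o F t) (wedge F))) I.

(* The forms of class [B^1] separate the chains of class [B^1], so at most one
   [J] represents the cell. *)
Definition cell_chain o F sigma (J : differential_chain k ip U 1) : Prop :=
  forall omega, Bform ip 1 omega ->
    cell_integral omega o F sigma (chain_integral omega J).

Definition polyhedral_chain : set (differential_chain k ip U 1) :=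
  [set P | exists m (a : 'I_m -> R) (J : 'I_m -> differential_chain k ip U 1),
    (forall i, exists o F sigma,
       oriented_cell o F sigma /\ cell_chain o F sigma (J i)) /\
    P = \sum_(i < m) a i *: J i].

End Polyhedral.

Arguments polyhedral_chain {R n} k ip U.

(* Main.v *)
Require Import Defs.
From mathcomp Require Import all_boot all_order all_algebra.
From mathcomp Require Import perm sesquilinear.
From mathcomp Require Import all_classical all_reals all_analysis.
From mathcomp Require Import ring lra.

(** Dirac chains are dense in the completion, and they are linear combinations
    of chains [(p; e_I)], where [p] is a point of [U] and [e_I] a basis k-vector
    ([kvec_basis], [dirac_chain_decomp]). So it suffices to approximate
    [(p; e_I)] by polyhedral chains, and this is done in the B^1 norm: the B^r
    norm is smaller ([Bnorm_antitone]), hence the linking map extends a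
    1-Lipschitz map and keeps the estimate ([completion_extend_lipschitz]).

    The approximation is the chain of the k-dimensional cube with corner [p],
    edge [c] and directions [e_i] for [i] in [I], divided by its volume [c ^+ k].
    The reason is that moving a Dirac chain by a vector [u] inside a convex part
    of [U] is a first difference, of B^1 norm at most [|u|] times the mass
    ([Bnorm_dirac_sub]). The map sending a point [t] of the cube to the Dirac
    chain [(t; e_I)] is therefore Lipschitz for the B^1 norm
    ([frame_dirac_lipschitz]), and its Riemann sums form a Cauchy net: two sums
    are compared on the overlaps of the boxes of their subdivisions
    ([vriemann_sum_near], [vriemann_sum_limit]). The limit [J] represents the
    cube, because a form of class B^1 is bounded for the B^1 norm and maps these
    sums to the Riemann sums of its integral over the cube ([box_cell_chain]).
    The undivided cube tagged at [p] is itself a Riemann sum, so [J] is at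
    distance at most a constant times [c] times [c ^+ k] from
    [c ^+ k *: (p; e_I)], and dividing by [c ^+ k] leaves an error proportional to
    [c] ([approximable_basis]).

    That forms are bounded ([Bform_bounded]) rests on the mass being a norm and
    not just a seminorm ([mass_eq0]). The coordinates of a simple k-vector are
    minors of the matrix of its factors, and Hadamard's inequality bounds them
    by the square root of the Gram determinant ([wedge_coord_bounded]). *)

Set Implicit Arguments.
Unset Strict Implicit.
Unset Printing Implicit Defensive.

Import Order.TTheory GRing.Theory Num.Theory.
Import numFieldNormedType.Exports.

Local Open Scope classical_set_scope.
Local Open Scope ring_scope.

(** * Inner products on row vectors *)

Section InnerProduct.
Context {R : realType} {n : nat} (ip : {dot 'rV[R]_n for idfun}).
Implicit Types (u v : 'rV[R]_n).

Lemma ipC u v : ip u v = ip v u.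
Proof. by rewrite hermC expr0 mul1r. Qed.

Lemma ipDl u v w : ip (u + v) w = ip u w + ip v w.
Proof. exact: linearDl. Qed.

Lemma ipDr w u v : ip w (u + v) = ip w u + ip w v.
Proof. exact: linearDr. Qed.

Lemma ipZl a u v : ip (a *: u) v = a * ip u v.
Proof. exact: linearZl_LR. Qed.

Lemma ipZr a u v : ip u (a *: v) = a * ip u v.
Proof. exact: linearZr_LR. Qed.

Lemma ipNl u v : ip (- u) v = - ip u v.
Proof. exact: linearNl. Qed.

Lemma ip_suml I (s : seq I) (F : I -> 'rV[R]_n) v :
  ip (\sum_(i <- s) F i) v = \sum_(i <- s) ip (F i) v.
Proof. exact: linear_sumlz. Qed.

Lemma ip_sumr I (s : seq I) (F : I -> 'rV[R]_n) v :
  ip v (\sum_(i <- s) F i) = \sum_(i <- s) ip v (F i).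
Proof. exact: linear_sumr. Qed.

Lemma ip_eq0 u : ip u u = 0 -> u = 0.
Proof.
move=> u0; apply/eqP; apply: contraT => /(@neq0_dnorm_gt0 _ _ _ ip).
by rewrite u0 ltxx.
Qed.

Lemma ip_ge0 u : 0 <= ip u u.
Proof.
have [->|/(@neq0_dnorm_gt0 _ _ _ ip)/ltW//] := eqVneq u 0.
by rewrite linear0r.
Qed.

Lemma ip_norm_ge0 u : 0 <= ip_norm ip u.
Proof. exact: sqrtr_ge0. Qed.

Lemma ip_norm_eq0 u : ip_norm ip u = 0 -> u = 0.
Proof.
move=> /eqP; rewrite /ip_norm sqrtr_eq0 => u0.
by apply: ip_eq0; apply/eqP; rewrite eq_le u0 ip_ge0.
Qed.

Lemma ip_cauchy_schwarz u v : `|ip u v| <= ip_norm ip u * ip_norm ip v.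
Proof.
have [->|v0] := eqVneq v 0.
  by rewrite linear0r normr0 mulr_ge0// ip_norm_ge0.
rewrite /ip_norm -sqrtrM ?ip_ge0// -sqrtr_sqr ler_wsqrtr//.
have vv : 0 < ip v v by exact: neq0_dnorm_gt0.
(* the component of u orthogonal to v has nonnegative square *)
have := ip_ge0 (ip v v *: u - ip u v *: v).
rewrite -scaleNr !ipDl !ipDr !ipZl !ipZr (ipC v u).
rewrite (_ : _ + _ = ip v v * (ip u u * ip v v - ip u v ^+ 2)); last by ring.
by rewrite pmulr_rge0// subr_ge0.
Qed.

(** The coordinates of a vector are inner products with fixed vectors: this
    bounds the coordinates by the norm of [ip], and it presents the faces of a
    coordinate box as half spaces for [ip]. The fixed vectors are the rows of
    the inverse Gram matrix, which is invertible because [ip] is definite. *)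
Lemma ip_riesz : exists a : 'I_n -> 'rV[R]_n, forall i v, ip (a i) v = v 0 i.
Proof.
pose G := \matrix_(i, j) ip 'e_i 'e_j.
have ipG u j : (u *m G) 0 j = ip u 'e_j.
  rewrite [in RHS](row_sum_delta u) ip_suml mxE.
  by apply: eq_bigr => i _; rewrite mxE ipZl.
have Gu : G \in unitmx.
  rewrite -row_free_unit; apply: inj_row_free => u uG.
  apply: ip_eq0; rewrite [X in ip _ X](row_sum_delta u) ip_sumr big1// => j _.
  by rewrite ipZr -ipG uG mxE mulr0.
exists (fun i => row i (invmx G)) => i v.
rewrite [X in ip _ X](row_sum_delta v) ip_sumr (bigD1 i)//= big1 => [|j ji].
  by rewrite ipZr -ipG -row_mul mulVmx// row1 mxE !eqxx mulr1 addr0.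
by rewrite ipZr -ipG -row_mul mulVmx// row1 mxE (negPf ji) mulr0.
Qed.

(** Displacements are measured by their coordinates in the subdivisions of a
    box, but by the norm of [ip] in the cost of a difference chain. *)
Lemma ip_norm_bounded :
  exists2 K, 0 < K & forall u (D : R), 0 <= D -> (forall i, `|u 0 i| <= D) ->
    ip_norm ip u <= K * D.
Proof.
pose S := 1 + \sum_i \sum_j `|ip 'e_i 'e_j|.
have S0 : 0 < S by rewrite ltr_pwDl// !sumr_ge0// => i _; rewrite sumr_ge0.
exists (Num.sqrt S); first by rewrite sqrtr_gt0.
move=> u D D0 uD.
rewrite -(ger0_norm D0) -(sqrtr_sqr D) -sqrtrM ?(ltW S0)// /ip_norm ler_wsqrtr//.
rewrite [in leLHS](row_sum_delta u) ip_suml.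
apply: le_trans (_ : (\sum_i \sum_j `|ip 'e_i 'e_j|) * D ^+ 2 <= _); last first.
  by rewrite ler_wpM2r ?sqr_ge0// lerDr.
rewrite mulr_suml ler_sum// => i _; rewrite ip_sumr mulr_suml ler_sum// => j _.
rewrite ipZl ipZr; apply: le_trans (ler_norm _) _.
rewrite !normrM mulrA mulrC ler_wpM2l// expr2.
by apply: ler_pM => //; exact: uD.
Qed.

End InnerProduct.

(** * The mass of a k-vector controls its coordinates *)

Section Mass.
Context {R : realType} {n k : nat} (ip : {dot 'rV[R]_n for idfun}).
Implicit Types (M : 'M[R]_(k, n)) (alpha : kvec R n k) (I : multi_index n k).

(** Gram-Schmidt orthogonalization without normalization, so that it applies
    to dependent families and preserves both Gram and coordinate
    determinants. *)
Lemma gram_schmidt m (M : 'M[R]_(m, n)) :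
  exists2 T : 'M[R]_m, \det T = 1 &
    forall i j, i != j -> ip (row i (T *m M)) (row j (T *m M)) = 0.
Proof.
elim: m M => [|m IH] M.
  by exists 1%:M; [rewrite det1 | case].
pose v := usubmx (M : 'M[R]_(1 + m, n)); pose N := dsubmx (M : 'M[R]_(1 + m, n)).
(* when v = 0 the coefficients vanish, and there is nothing to project *)
pose c := \col_i (ip (row i N) v / ip v v).
have cN i : ip (row i (N - c *m v)) v = 0.
  rewrite raddfB/= row_mul -scaleN1r ipDl ipZl.
  rewrite (_ : row i c *m v = c i 0 *: v); last first.
    by rewrite [row i c]mx11_scalar mul_scalar_mx !mxE.
  rewrite ipZl mxE mulN1r; have [v0|v0] := eqVneq (ip v v) 0.
    by rewrite v0 mulr0 subr0 (ip_eq0 v0) linear0r.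
  by rewrite divfK// subrr.
have [T detT ortho] := IH (N - c *m v).
pose T1 : 'M[R]_(1 + m) := block_mx 1%:M 0 (- (T *m c)) T.
have detT1 : \det T1 = 1 by rewrite det_lblock det1 detT mulr1.
have T1M : T1 *m (M : 'M[R]_(1 + m, n)) = col_mx v (T *m (N - c *m v)).
  rewrite -{1}(vsubmxK (M : 'M[R]_(1 + m, n)))
    mul_block_col mul1mx mul0mx addr0 mulNmx addrC.
  by rewrite -mulmxA -mulmxBr.
exists T1 => //; rewrite [_ *m _]T1M.
have vT i : ip (row i (T *m (N - c *m v))) v = 0.
  rewrite row_mul mulmx_sum_row ip_suml big1// => j _.
  by rewrite ipZl cN mulr0.
suff ortho1 (i j : 'I_(1 + m)) : i != j ->
    ip (row i (col_mx v (T *m (N - c *m v))))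
       (row j (col_mx v (T *m (N - c *m v)))) = 0 by exact: ortho1.
rewrite -(splitK i) -(splitK j).
case: (fintype.split _) => i' /=; case: (fintype.split _) => j' /=.
- by rewrite !ord1 eqxx.
- by move=> _; rewrite rowKu rowKd row_id ipC vT.
- by move=> _; rewrite rowKu rowKd row_id vT.
- by rewrite !rowKd => ij; apply: ortho; apply: contra ij => /eqP->.
Qed.

Lemma gram_mul (T : 'M[R]_k) M : gram ip (T *m M) = T *m gram ip M *m T^T.
Proof.
apply/matrixP => i j; rewrite mxE !row_mul !mulmx_sum_row ip_suml.
rewrite [RHS]mxE; under [RHS]eq_bigr do rewrite mxE mulr_suml.
rewrite [RHS]exchange_big/=; apply: eq_bigr => a _; rewrite ip_sumr.
apply: eq_bigr => b _; rewrite ipZl ipZr !mxE.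
by rewrite mulrCA mulrC.
Qed.

Lemma wedge_mul (T : 'M[R]_k) M : wedge (T *m M) = \det T *: wedge M.
Proof.
by apply/ffunP => I; rewrite !ffunE -mulmx_colsub det_mulmx.
Qed.

(** Hadamard's inequality for an orthogonal family; the general case follows
    because both sides are invariant under unimodular row operations. *)
Lemma wedge_coord_bounded :
  exists2 C, 0 <= C & forall M I, `|wedge M I| <= C * Num.sqrt (\det (gram ip M)).
Proof.
have [a aE] := ip_riesz ip.
pose c := \sum_i ip_norm ip (a i).
have c0 : 0 <= c by apply: sumr_ge0 => i _; exact: ip_norm_ge0.
exists (\sum_(s : 'S_k) \prod_(i < k) c).
  by apply: sumr_ge0 => s _; exact: prodr_ge0.
move=> M I; have [T detT ortho] := gram_schmidt M.

have -> : wedge M = wedge (T *m M) by rewrite wedge_mul detT scale1r.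
have -> : \det (gram ip M) = \det (gram ip (T *m M)).
  by rewrite gram_mul !det_mulmx det_tr detT mul1r mulr1.
move: (T *m M) ortho => {}M ortho.
have -> : gram ip M = diag_mx (\row_i ip (row i M) (row i M)).
  apply/matrixP => i j; rewrite !mxE; have [->|/ortho ->] := eqVneq i j.
    by rewrite mulr1n.
  by rewrite mulr0n.
rewrite det_diag ffunE; apply: le_trans (ler_norm_sum _ _ _) _.
rewrite mulr_suml; apply: ler_sum => s _.
rewrite normrM normr_sign mul1r normr_prod.
rewrite (_ : Num.sqrt _ = \prod_i ip_norm ip (row i M)); last first.
  under eq_bigr do rewrite mxE -(sqr_sqrtr (ip_ge0 ip _)).
  by rewrite prodrXl sqrtr_sqr ger0_norm// prodr_ge0// => i _; exact: sqrtr_ge0.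
rewrite -big_split/= ler_prod// => i _.
rewrite normr_ge0/=.
have -> : colsub (tnth (val I)) M i (s i) = ip (a (tnth (val I) (s i))) (row i M).
  by rewrite aE !mxE.
apply: le_trans (ip_cauchy_schwarz _ _ _) _.
rewrite ler_wpM2r ?ip_norm_ge0//.
rewrite /c (bigD1 (tnth (val I) (s i)))//= lerDl sumr_ge0// => *.
exact: ip_norm_ge0.
Qed.

Definition basis_frame I : 'M[R]_(k, n) := rowsub (tnth (val I)) 1%:M.

Lemma multi_index_inj I : injective (tnth (val I)).
Proof.
have := valP I; rewrite ltn_sorted_uniq_leq map_inj_uniq; last exact: val_inj.
by move=> /andP[/tuple_uniqP].
Qed.

Lemma wedge_basis_frame I J : wedge (basis_frame I) J = (I == J)%:R.
Proof.
rewrite ffunE; have [<-|IJ] := eqVneq I J.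
  rewrite (_ : colsub _ _ = 1%:M) ?det1//; apply/matrixP => i j.
  by rewrite !mxE (inj_eq (@multi_index_inj _)).
have [i iJ] : exists i, tnth (val I) i \notin val J.
  apply/existsP; apply: contraR IJ; rewrite negb_exists => /forallP sIJ.
  apply/eqP/val_inj/val_inj/(inj_map val_inj).
  have sub : {subset val I <= val J}.
    by move=> _ /tnthP[i ->]; have := sIJ i; rewrite negbK.
  have uI : uniq (val I) by apply/tuple_uniqP/multi_index_inj.
  apply: (irr_sorted_eq ltn_trans ltnn (valP I) (valP J)).
  have [|_ eqIJ] := uniq_min_size uI sub; first by rewrite !size_tuple.
  exact: eq_mem_map.
rewrite (expand_det_row _ i) big1// => j _; rewrite !mxE.
case: eqP => [E|_]; last by rewrite mul0r.
by rewrite E mem_tnth in iJ.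
Qed.

Lemma kvec_basis alpha : alpha = \sum_I alpha I *: wedge (basis_frame I).
Proof.
apply/ffunP => J; rewrite sum_ffunE (bigD1 J)//= big1 => [|I IJ].
  by rewrite ffunE wedge_basis_frame eqxx addr0 [_ *: _]mulr1.
by rewrite ffunE wedge_basis_frame (negPf IJ) scaler0.
Qed.

(** A decomposition into simple k-vectors bounds each coordinate termwise. The
    set of decompositions is nonempty because the basis k-vectors are simple;
    otherwise the infimum would be the default value 0. *)
Lemma mass_coord_bounded :
  exists C, forall alpha I, `|alpha I| <= C * mass ip alpha.
Proof.
have [C C0 HC] := wedge_coord_bounded.
have C1 : 0 < C + 1 by rewrite ltr_wpDl.
exists (C + 1) => alpha I; rewrite mulrC -ler_pdivrMr//; apply: lb_le_inf.
  pose s := [seq (alpha J, basis_frame J) | J <- index_enum (multi_index n k)].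
  exists (\sum_(t <- s) simple_mass ip t), s => //.
  by rewrite big_map; exact: kvec_basis.
move=> _ [s aE ->]; rewrite ler_pdivrMr// aE sum_ffunE mulr_suml.
apply: le_trans (ler_norm_sum _ _ _) _; apply: ler_sum => t _.
rewrite ffunE normrM -mulrA ler_wpM2l// mulrC.
by apply: le_trans (HC _ _) _; rewrite ler_wpM2r ?sqrtr_ge0// lerDl.
Qed.

(** The seminorms of forms range over difference chains normalized to cost 1;
    a k-vector of mass 0 cannot be normalized, so it has to be 0 for these
    seminorms to control every difference chain. *)
Lemma mass_eq0 alpha : mass ip alpha = 0 -> alpha = 0.
Proof.
have [C HC] := mass_coord_bounded => a0; apply/ffunP => I; rewrite ffunE.
by apply/eqP; rewrite -normr_le0; have := HC alpha I; rewrite a0 mulr0.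
Qed.

End Mass.

(** * Extending Lipschitz maps to the completion *)

Section Extension.
Context {R : realType} {V : lmodType R} (N : seminorm V).

(** A Lipschitz map has a limit along the embedded points near [J], and the
    Lipschitz estimate survives in the limit; in particular the extension
    agrees with the map on the embedded space. *)
Lemma completion_extend_lipschitz (W : completeNormedModType R) (f : V -> W)
    (C : R) : 0 <= C -> (forall x y, `|f x - f y| <= C * N (x - y)) ->
  forall (J : completion N) v,
    `|completion_extend f J - f v| <= C * `|J - completion_embed N v|.
Proof.
move=> C0 fC J v.
have C1 : 0 < 1 + C by rewrite ltr_wpDr.
pose F := filter_from (nbhs J) (fun O => completion_embed N @^-1` O).
have FF : ProperFilter F.
  apply: filter_from_proper => [|O].
    apply: filter_from_filter; first by exists setT; exact: filterT.
    by move=> A B FA FB; exists (A `&` B) => //; exact: filterI.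
  rewrite nbhsE => -[A [oA JA] AO].
  have [|z [Az [x _ xz]]] := dense_completion_embed (N := N) _ oA; first by exists J.
  by exists x; apply: AO; rewrite xz.
have near_J (e : R) : 0 < e -> F [set x | `|J - completion_embed N x| < e].
  by move=> e0; exists (ball J e); [exact: nbhsx_ballx | move=> x].
have cf : cvg (f @ F).
  apply/cauchy_cvgP/cauchyP => e e0.
  have e2 : 0 < e / (1 + C) / 2 by rewrite !divr_gt0.
  have [x Jx] := filter_ex (near_J _ e2); exists (f x).
  apply: filterS (near_J _ e2) => y /= Jy; rewrite -ball_normE/=.
  apply: le_lt_trans (fC _ _) _.
  have xy : N (x - y) < e / (1 + C).
    rewrite -norm_completion_embed raddfB/= (splitr (e / _)).
    by rewrite (le_lt_trans (ler_distD J _ _))// ltrD// distrC.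
  apply: le_lt_trans (_ : (1 + C) * N (x - y) < e); last first.
    by rewrite mulrC -ltr_pdivlMr.
  by rewrite ler_wpM2r ?seminorm_ge0// lerDr.
apply/ler_addgt0Pr => e e0; have e1 : 0 < e / (1 + C) by rewrite divr_gt0.
have /cvgrPdist_lt/(_ _ e1) fl : f @ F --> completion_extend f J by [].
have [x [/= lx Jx]] := filter_ex (filterI fl (near_J _ e1)).
rewrite (le_trans (ler_distD (f x) _ _))//.
have xv : N (x - v) <= e / (1 + C) + `|J - completion_embed N v|.
  rewrite -norm_completion_embed raddfB/=.
  by rewrite (le_trans (ler_distD J _ _))// lerD2r distrC ltW.
apply: le_trans (lerD (ltW lx) (le_trans (fC x v) (ler_wpM2l C0 xv))) _.
by rewrite mulrDr addrA [leRHS]addrC lerD2r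
  -[X in X + _]mul1r -mulrDl mulrC divfK ?gt_eqF.
Qed.

End Extension.

(** * The B^r norm of Dirac chains and the forms of class B^r *)

Section DiracChains.
Context {R : realType} {n k : nat} (ip : {dot 'rV[R]_n for idfun}).
Context (U : set 'rV[R]_n).
Implicit Types (p q u : 'rV[R]_n) (alpha : kvec R n k).
Implicit Types (sigma : seq 'rV[R]_n) (A : dirac_chain k U).
Implicit Types omega : {scalar dirac_chain k U}.

Lemma sub_convex_hull (S : set 'rV[R]_n) : S `<=` convex_hull S.
Proof. by move=> x Sx C [_ SC]; exact: SC. Qed.

Lemma inside_convex (C : set 'rV[R]_n) sigma p alpha :
  @convex_set R 'rV[R]_n C -> C `<=` U ->
  chain_supp (delta_chain sigma p alpha) `<=` C -> inside U sigma p alpha.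
Proof. by move=> cC CU sC; apply: subset_trans CU; exact: smallest_sub. Qed.

Lemma point_chain_supp p alpha : chain_supp (point_chain p alpha) `<=` [set p].
Proof.
move=> q; rewrite /chain_supp/= /point_chain.
by have [->//|_] := eqVneq q p; rewrite eqxx.
Qed.

Lemma inside_point p alpha : U p -> inside U [::] p alpha.
Proof.
move=> Up; apply: (@inside_convex [set p]); first last.
- exact: point_chain_supp.
- by move=> _ ->.
- by move=> x y l; rewrite !inE/= => -> ->; rewrite convmm.
Qed.

Lemma delta_chain_finite sigma p alpha :
  finite_set (chain_supp (delta_chain sigma p alpha)).
Proof.
rewrite /delta_chain; have : finite_set (chain_supp (point_chain p alpha)).
  exact: sub_finite_set (@point_chain_supp p alpha) (finite_set1 p).
elim: sigma (point_chain p alpha) => //= u sigma IH A fA; apply: IH.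
apply: (@sub_finite_set _ _ ((fun q => q + u) @` chain_supp A `|` chain_supp A)).
  move=> q; rewrite /chain_supp/= /delta => dq.
  have [Aq|Aq] := eqVneq (A q) 0; last by right.
  left; exists (q - u); last by rewrite subrK.
  apply: contra_neq dq => Aqu.
  by rewrite [LHS](_ : _ = A (q - u) - A q)// Aqu Aq subrr.
by rewrite finite_setU; split => //; exact: finite_image.
Qed.

Lemma inside_dirac_chain sigma p alpha : inside U sigma p alpha ->
  exists A, val A = delta_chain sigma p alpha.
Proof.
move=> ins; suff dA : delta_chain sigma p alpha \in @dirac_pred R n k U.
  by exists (DiracChain dA).
apply/asboolP; split; first exact: delta_chain_finite.
by apply: subset_trans ins; exact: sub_convex_hull.
Qed.

Lemma val_dirac p alpha : U p -> val (Defs.dirac U p alpha) = point_chain p alpha.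
Proof.
move=> Up; have [A AE] := inside_dirac_chain (@inside_point p alpha Up).
by apply: insubdK; rewrite -[X in X \in _]AE; exact: valP.
Qed.

Lemma val_dirac_sum (I : Type) (s : seq I) (F : I -> dirac_chain k U) :
  val (\sum_(i <- s) F i) = \sum_(i <- s) val (F i).
Proof. by elim/big_ind2: _ => // _ A _ B <- <-. Qed.

Lemma dirac_chain_decomp A : exists2 s : seq 'rV[R]_n,
  (forall p, p \in s -> U p) & A = \sum_(p <- s) Defs.dirac U p (val A p).
Proof.
have /asboolP[/finite_seqP[/= s As] AU] := valP A.
have sU p : p \in undup s -> U p.
  by rewrite mem_undup => ps; apply: AU; rewrite As.
exists (undup s) => //; apply: val_inj; rewrite val_dirac_sum; apply/funext => q.
rewrite big_seq fct_sumE.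
rewrite (eq_bigr (fun p => if q == p then val A q else 0)); last first.
  by move=> p /sU Up; rewrite val_dirac// /point_chain; case: eqP => // ->.
rewrite -big_seq; have [qs|qs] := boolP (q \in undup s).
  rewrite (bigD1_seq q) ?undup_uniq//= eqxx big1 ?addr0// => p.
  by rewrite eq_sym => /negPf ->.
rewrite big_seq big1 => [|p ps]; last first.
  by case: eqP => // qp; rewrite qp ps in qs.
apply/eqP; apply: contraNT qs => Aq; rewrite mem_undup.
by have : [set` s] q by rewrite -As.
Qed.

Lemma Bcosts_ge0 r A : lbound (Bcosts ip r A) 0.
Proof.
move=> _ [s [_ _ ->]]; apply: sumr_ge0 => t _.
by rewrite mulr_ge0 ?list_norm_ge0 ?mass_ge0.
Qed.

Lemma Bcosts_nonempty r A : Bcosts ip r A !=set0.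
Proof.
have [s sU AE] := dirac_chain_decomp A.
pose ts := [seq ([::] : seq 'rV[R]_n, p, val A p) | p <- s].
exists (\sum_(t <- ts) term_cost ip t), ts; split=> //.
  by move=> _ /mapP[p ps ->]; split => //=; exact/inside_point/sU.
rewrite [in LHS]AE val_dirac_sum big_map big_seq [RHS]big_seq.
by apply: eq_bigr => p ps; rewrite val_dirac//; exact: sU.
Qed.

Lemma Bnorm_term_le r A sigma p alpha :
  (size sigma <= r)%N -> inside U sigma p alpha ->
  val A = delta_chain sigma p alpha ->
  Bnorm k ip U r A <= list_norm ip sigma * mass ip alpha.
Proof.
move=> sr ins AE; apply: ge_inf; first by exists 0; exact: Bcosts_ge0.
exists [:: (sigma, p, alpha)]; rewrite !big_seq1; split => //.
by move=> t; rewrite inE => /eqP->; split.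
Qed.

Lemma Bnorm_antitone r r' A : (r' <= r)%N -> Bnorm k ip U r A <= Bnorm k ip U r' A.
Proof.
move=> rr; apply: lb_le_inf; first exact: Bcosts_nonempty.
move=> c [s [adm AE cE]]; apply: ge_inf; first by exists 0; exact: Bcosts_ge0.
by exists s; split => // t /adm[sz ins]; split => //; exact: leq_trans rr.
Qed.

(** The first difference [Delta_(q - p) (p; alpha)] is the reason why chains of
    class [B^1] see nearby points as nearby. *)
Lemma Bnorm_dirac_sub (C : set 'rV[R]_n) p q alpha :
  @convex_set R 'rV[R]_n C -> C `<=` U -> C p -> C q ->
  Bnorm k ip U 1 (Defs.dirac U q alpha - Defs.dirac U p alpha)
    <= ip_norm ip (q - p) * mass ip alpha.
Proof.
move=> cC CU Cp Cq.
have E : delta_chain [:: q - p] p alpha = point_chain q alpha - point_chain p alpha.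
  apply/funext => x; rewrite /delta_chain/= /delta /translate.
  by congr (_ - _); rewrite /point_chain subr_eq addrC subrK.
rewrite -[ip_norm ip _](_ : list_norm ip [:: q - p] = _); last exact: big_seq1.
apply: (@Bnorm_term_le _ _ _ p) => //; last first.
  by rewrite E -(val_dirac _ (CU _ Cp)) -(val_dirac _ (CU _ Cq)).
apply: (inside_convex cC CU) => x; rewrite E /chain_supp/= => Ex.
have [->//|xp] := eqVneq x p; have [->//|xq] := eqVneq x q.
move: Ex; rewrite [X in X != _](_ : _ = point_chain q alpha x - point_chain p alpha x)//.
by rewrite /point_chain (negPf xp) (negPf xq) subrr eqxx.
Qed.

Lemma list_norm_eq0 sigma p alpha :
  list_norm ip sigma = 0 -> delta_chain sigma p alpha = 0.
Proof.
have delta0 s : foldl (@delta R n k) (0 : 'rV[R]_n -> kvec R n k) s = 0.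
  by elim: s => //= u s IH; rewrite /delta subr0 IH.
rewrite /delta_chain /list_norm.
elim: sigma (point_chain p alpha) => [|u s IH] A.
  by rewrite big_nil => /eqP; rewrite oner_eq0.
rewrite big_cons /= => /eqP; rewrite mulf_eq0 => /orP[/eqP/ip_norm_eq0 ->|/eqP/IH ->//].
rewrite (_ : delta A 0 = 0) ?delta0//; apply/funext => q.
by rewrite /delta /translate/= [LHS](_ : _ = A (q - 0) - A q)// subr0 subrr.
Qed.

Lemma delta_chain0 sigma p : delta_chain sigma p (0 : kvec R n k) = 0.
Proof. by rewrite -(scale0r (0 : kvec R n k)) delta_chainZ scale0r. Qed.

(** Every admissible decomposition of [A] is mapped termwise by [omega]. A term
    of nonzero cost is rescaled to cost 1; a term of cost 0 is the zero
    chain. *)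
Lemma Bform_bounded r omega : Bform ip r omega ->
  exists2 C, 0 <= C & forall A, `|omega A| <= C * Bnorm k ip U r A.
Proof.
rewrite /Bform; set c := form_norm _ _ _ => coo.
have c0 : (0 <= c)%E by rewrite /c /form_norm bigmax_idl le_max lexx.
have cE : c = (fine c)%:E by rewrite fineK// ge0_fin_numE.
exists (fine c + 1); first by rewrite addr_ge0// fine_ge0.
have bound A sigma p alpha : (size sigma <= r)%N -> inside U sigma p alpha ->
    val A = delta_chain sigma p alpha ->
    `|omega A| <= fine c * (list_norm ip sigma * mass ip alpha).
  move=> sr ins AE; have [m0|m0] := eqVneq (list_norm ip sigma * mass ip alpha) 0.
    have -> : A = 0.
      apply: val_inj; rewrite AE /=; move/eqP: m0; rewrite mulf_eq0.
      move=> /orP[/eqP/list_norm_eq0 ->//|/eqP/mass_eq0 ->]; exact: delta_chain0.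
    by rewrite linear0 normr0 m0 mulr0.
  set m := _ * _ in m0 *.
  have mgt0 : 0 < m by rewrite lt_neqAle eq_sym m0 mulr_ge0 ?list_norm_ge0 ?mass_ge0.
  rewrite -ler_pdivrMr// -(ger0_norm (ltW mgt0)) -normfV -normrM mulrC.
  rewrite -[_ * omega A]linearZ -lee_fin -cE.
  apply: (@le_trans _ _ (form_seminorm ip (size sigma) omega)).
    apply: ereal_sup_ubound; exists (m^-1 *: A) => //.
    exists sigma, p, (m^-1 *: alpha); split => //.
    - by rewrite massZ ger0_norm ?invr_ge0 ?ltW// mulrCA mulVf.
    - exact: insideZ.
    - by rewrite delta_chainZ -AE.
  have sr1 : (size sigma < r.+1)%N by [].
  rewrite /c /form_norm (bigmaxD1 (Ordinal sr1))//= le_max lexx//.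
move=> A; rewrite mulrC -ler_pdivrMr ?ltr_wpDl ?fine_ge0//.
apply: lb_le_inf; first exact: Bcosts_nonempty.
move=> _ [s [adm AE ->]]; rewrite ler_pdivrMr ?ltr_wpDl ?fine_ge0// mulrC.
have exD t : exists B : dirac_chain k U, t \in s -> val B = term_chain t.
  have [ts|ts] := boolP (t \in s); last by exists 0.
  by have [_ /inside_dirac_chain[B BE]] := adm t ts; exists B.
have [D DE] := choice exD.
have -> : A = \sum_(t <- s) D t.
  by apply: val_inj; rewrite val_dirac_sum AE; apply: eq_big_seq => t /DE.
rewrite linear_sum mulr_sumr; apply: le_trans (ler_norm_sum _ _ _) _.
rewrite big_seq [leRHS]big_seq; apply: ler_sum => t ts.
have [sr ins] := adm t ts; apply: le_trans (bound _ _ _ _ sr ins (DE t ts)) _.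
by rewrite ler_wpM2r ?lerDl// mulr_ge0 ?list_norm_ge0 ?mass_ge0.
Qed.

End DiracChains.

(** * Comparing Riemann sums over two subdivisions *)

Section RiemannSums.
Context {R : realType} {k : nat}.
Implicit Types (a b : 'rV[R]_k) (s : 'I_k -> nat -> R).

(** The length of the intersection of [[x, y]] and [[z, w]]. *)
Definition overlap (x y z w : R) : R := Num.max 0 (Num.min y w - Num.max x z).

Lemma overlapC x y z w : overlap x y z w = overlap z w x y.
Proof. by rewrite /overlap [Num.min w y]minC [Num.max z x]maxC. Qed.

Lemma overlap_ge0 x y z w : 0 <= overlap x y z w.
Proof. by rewrite /overlap le_max lexx. Qed.

Lemma overlap_near (d d' x y z w t t' : R) :
  x <= t <= y -> z <= t' <= w -> y - x < d -> w - z < d' ->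
  overlap x y z w != 0 -> `|t - t'| <= d + d'.
Proof.
rewrite /overlap => /andP[xt ty] /andP[zt tw] yx wz.
have [h|h] := leP 0 (Num.min y w - Num.max x z); last by rewrite eqxx.
move=> _; move: h; rewrite subr_ge0 le_min !ge_max ler_norml.
by move=> /andP[/andP[? ?] /andP[? ?]]; apply/andP; split; lra.
Qed.

(** Clamping to [[x, y]] turns overlaps with consecutive intervals into a
    telescoping sum. *)
Lemma overlap_sum N (u : nat -> R) x y :
  (forall j, (j < N)%N -> u j <= u j.+1) ->
  u 0%N <= x -> x <= y -> y <= u N ->
  \sum_(j < N) overlap x y (u j) (u j.+1) = y - x.
Proof.
move=> um ux xy yu; pose clamp z := Num.max x (Num.min y z).
rewrite (eq_bigr (fun j : 'I_N => clamp (u j.+1) - clamp (u j))); last first.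
  move=> j _; have := um j (ltn_ord j); rewrite /overlap /clamp.
  move: (u j) (u j.+1) => z w zw.
  case: (leP y w) => ?; case: (leP x z) => ?; case: (leP y z) => ?;
  case: (leP x y) => ?; case: (leP x w) => ?; case: (leP 0 (_ - _)) => ?;
  try (case: (leP x z) => ?); lra.
rewrite -(big_mkord xpredT (fun j => clamp (u j.+1) - clamp (u j))).
rewrite telescope_sumr// /clamp (min_idPl yu) (max_idPr xy).
by rewrite (min_idPr (le_trans ux xy)) (max_idPl ux).
Qed.

Definition cell_volume N s (m : {ffun 'I_k -> 'I_N}) : R :=
  \prod_i (s i (m i).+1 - s i (m i)).

(** With values in Dirac chains, these sums approximate a cell, and a form
    turns them into the scalar Riemann sums of the integral over this cell. *)
Definition vriemann_sum (V : lmodType R) N s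
    (t : {ffun 'I_k -> 'I_N} -> 'rV[R]_k) (f : 'rV[R]_k -> V) : V :=
  \sum_m cell_volume s m *: f (t m).

Lemma subdivision_bounds a b d N s i j : subdivision a b d N s ->
  (j <= N)%N -> a 0 i <= s i j <= b 0 i.
Proof.
move=> sd; have [<- <- step] := sd i.
have up u v : (u <= v)%N -> (v <= N)%N -> s i u <= s i v.
  elim: v => [|v IH]; first by rewrite leqn0 => /eqP->.
  rewrite leq_eqVlt => /orP[/eqP->//|uv] vN.
  have /andP[] := step _ vN; rewrite subr_ge0 => + _; apply: le_trans.
  by apply: IH => //; exact: ltnW.
by move=> jN; rewrite !up.
Qed.

Lemma cell_volume_sum a b d N s : subdivision a b d N s ->
  \sum_(m : {ffun 'I_k -> 'I_N}) cell_volume s m = \prod_i (b 0 i - a 0 i).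
Proof.
move=> sd; rewrite -(bigA_distr_bigA (fun i (j : 'I_N) => s i j.+1 - s i j)).
apply: eq_bigr => i _; have [<- <- _] := sd i.
by rewrite -(big_mkord xpredT (fun j => s i j.+1 - s i j)) telescope_sumr.
Qed.

Lemma cell_volume_overlap a b d d' N N' s s' (m : {ffun 'I_k -> 'I_N}) :
  subdivision a b d N s -> subdivision a b d' N' s' ->
  cell_volume s m = \sum_(m' : {ffun 'I_k -> 'I_N'})
    \prod_i overlap (s i (m i)) (s i (m i).+1) (s' i (m' i)) (s' i (m' i).+1).
Proof.
move=> sd sd'; rewrite -(bigA_distr_bigA (fun i (j : 'I_N') =>
  overlap (s i (m i)) (s i (m i).+1) (s' i j) (s' i j.+1))).
apply: eq_bigr => i _; have [s'0 s'N step'] := sd' i; have [_ _ step] := sd i.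
have /andP[am _] := subdivision_bounds i sd (ltnW (ltn_ord (m i))).
have /andP[_ bm] := subdivision_bounds i sd (ltn_ord (m i)).
rewrite overlap_sum ?s'0 ?s'N// => [j /step' /andP[]|].
  by rewrite subr_ge0.
by have /andP[] := step _ (ltn_ord (m i)); rewrite subr_ge0.
Qed.

Lemma seminorm_sum (V : lmodType R) (Q : seminorm V) (I : finType) (F : I -> V) :
  Q (\sum_i F i) <= \sum_i Q (F i).
Proof.
elim/big_ind2: _ => //; first by rewrite seminorm0.
by move=> x u y v xu yv; apply: le_trans (seminormD _ _ _) (lerD xu yv).
Qed.

(** Both sums are refined by the overlaps of the boxes of the two subdivisions;
    only overlapping boxes contribute, and their tags are close. *)
Lemma vriemann_sum_near (V : lmodType R) (Q : seminorm V) (f : 'rV[R]_k -> V)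
    a b d d' N N' s s' (t : {ffun 'I_k -> 'I_N} -> 'rV[R]_k)
    (t' : {ffun 'I_k -> 'I_N'} -> 'rV[R]_k) (w : R) :
  subdivision a b d N s -> tags s t -> subdivision a b d' N' s' -> tags s' t' ->
  (forall x y : 'rV[R]_k, (forall i, a 0 i <= x 0 i <= b 0 i) ->
     (forall i, a 0 i <= y 0 i <= b 0 i) ->
     (forall i, `|x 0 i - y 0 i| <= d + d') -> Q (f x - f y) <= w) ->
  Q (vriemann_sum s t f - vriemann_sum s' t' f)
    <= w * \prod_i (b 0 i - a 0 i).
Proof.
move=> sd tg sd' tg' fw.
have tags_in e M z (p : {ffun 'I_k -> 'I_M} -> 'rV[R]_k) m i :
    subdivision a b e M z -> tags z p -> a 0 i <= p m 0 i <= b 0 i.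
  move=> zd zp; have /andP[z1 z2] := zp m i.
  have /andP[am _] := subdivision_bounds i zd (ltnW (ltn_ord (m i))).
  have /andP[_ bm] := subdivision_bounds i zd (ltn_ord (m i)).
  by rewrite (le_trans am z1) (le_trans z2 bm).
pose o (m : {ffun 'I_k -> 'I_N}) (m' : {ffun 'I_k -> 'I_N'}) := \prod_i
  overlap (s i (m i)) (s i (m i).+1) (s' i (m' i)) (s' i (m' i).+1).
have vo m : cell_volume s m = \sum_m' o m m' by exact: cell_volume_overlap sd sd'.
have vo' m' : cell_volume s' m' = \sum_m o m m'.
  rewrite (cell_volume_overlap _ sd' sd); apply: eq_bigr => m _.
  by apply: eq_bigr => i _; rewrite overlapC.
rewrite /vriemann_sum; under [X in X - _]eq_bigr do rewrite vo scaler_suml.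
under [X in _ - X]eq_bigr do rewrite vo' scaler_suml.
rewrite [X in _ - X]exchange_big/= -sumrB.
apply: le_trans (seminorm_sum _ _) _.
rewrite -(cell_volume_sum sd) mulr_sumr; apply: ler_sum => m _.
rewrite -sumrB vo mulr_sumr; apply: le_trans (seminorm_sum _ _) _.
apply: ler_sum => m' _; rewrite -scalerBr seminormZ.
have [->|o0] := eqVneq (o m m') 0; first by rewrite normr0 mul0r mulr0.
have oge : 0 <= o m m' by apply: prodr_ge0 => i _; exact: overlap_ge0.
rewrite ger0_norm// mulrC ler_wpM2r//; apply: fw => i.
- exact: tags_in sd tg.
- exact: tags_in sd' tg'.
- have [_ _ step] := sd i; have [_ _ step'] := sd' i.
  apply: (overlap_near (tg m i) (tg' m' i)).
  + by have /andP[] := step _ (ltn_ord (m i)).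
  + by have /andP[] := step' _ (ltn_ord (m' i)).
  + by move/prodf_neq0 : o0; exact.
Qed.

End RiemannSums.

(** * Chains represented by cells *)

Section RiemannLimit.
Context {R : realType} {k : nat} {V : lmodType R} (Q : seminorm V).
Implicit Types (a b : 'rV[R]_k).

Definition in_box a b : set 'rV[R]_k := [set x | forall i, a 0 i <= x 0 i <= b 0 i].

Definition lipschitz_on (D : set 'rV[R]_k) (L : R) (f : 'rV[R]_k -> V) : Prop :=
  forall x y w, D x -> D y -> 0 <= w -> (forall i, `|x 0 i - y 0 i| <= w) ->
    Q (f x - f y) <= L * w.

Definition uniform_points a b (m : nat) (i : 'I_k) (j : nat) : R :=
  a 0 i + (b 0 i - a 0 i) * (j%:R / m.+1%:R).

(** A bound on the mesh that is strict, as [subdivision] demands, even when a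
    side of the box is a point: hence the summand 1. *)
Definition uniform_mesh a b (m : nat) : R :=
  (1 + \sum_i (b 0 i - a 0 i)) * m.+1%:R^-1.

Lemma uniform_subdivision a b m : (forall i, a 0 i <= b 0 i) ->
  subdivision a b (uniform_mesh a b m) m.+1 (uniform_points a b m).
Proof.
move=> ab i; have m0 : 0 < m.+1%:R :> R by [].
split=> [||j _]; rewrite /uniform_points.
- by rewrite mul0r mulr0 addr0.
- by rewrite divff ?gt_eqF// mulr1 addrC subrK.
rewrite opprD addrACA subrr add0r -mulrBr -mulrBl -natrB// subSnn mul1r.
rewrite mulr_ge0 ?subr_ge0 ?invr_ge0//= ltr_pM2r ?invr_gt0//.
rewrite (bigD1 i)//= addrCA ltrDl ltr_pwDl//.
by apply: sumr_ge0 => j' _; rewrite subr_ge0.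
Qed.

Lemma uniform_mesh_ge0 a b m : (forall i, a 0 i <= b 0 i) -> 0 <= uniform_mesh a b m.
Proof.
move=> ab; rewrite mulr_ge0 ?invr_ge0// addr_ge0// sumr_ge0// => i _.
by rewrite subr_ge0.
Qed.

Lemma uniform_mesh_small a b (e : R) : (forall i, a 0 i <= b 0 i) -> 0 < e ->
  exists M, forall m, (M <= m)%N -> uniform_mesh a b m < e.
Proof.
move=> ab e0; rewrite /uniform_mesh; set B := 1 + _.
have B0 : 0 < B.
  by rewrite /B ltr_pwDl// sumr_ge0// => i _; rewrite subr_ge0.
have eB : 0 < e / B by rewrite divr_gt0.
have [M _ HM] := near_infty_natSinv_lt (PosNum eB).
exists M => m Mm; rewrite mulrC -ltr_pdivlMr//; exact: (HM m Mm).
Qed.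

(** The Riemann sums of a Lipschitz function form a Cauchy net, by
    [vriemann_sum_near]. The limit is built from the uniform subdivisions; the
    factor 2 leaves room for comparing a subdivision of mesh [d] with uniform
    ones that are finer than [d]. *)
Lemma vriemann_sum_limit a b (L : R) (f : 'rV[R]_k -> V) :
  (forall i, a 0 i <= b 0 i) -> 0 <= L -> lipschitz_on (in_box a b) L f ->
  exists J : completion Q, forall d N s (t : {ffun 'I_k -> 'I_N} -> 'rV[R]_k),
    0 < d -> subdivision a b d N s -> tags s t ->
    `|J - completion_embed Q (vriemann_sum s t f)|
      <= 2 * L * d * \prod_i (b 0 i - a 0 i).
Proof.
move=> ab L0 fL; set vol := \prod_i _.
have vol0 : 0 <= vol by apply: prodr_ge0 => i _; rewrite subr_ge0.
have near d d' N N' s s' (t : {ffun 'I_k -> 'I_N} -> 'rV[R]_k)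
    (t' : {ffun 'I_k -> 'I_N'} -> 'rV[R]_k) : 0 <= d -> 0 <= d' ->
    subdivision a b d N s -> tags s t -> subdivision a b d' N' s' -> tags s' t' ->
    Q (vriemann_sum s t f - vriemann_sum s' t' f) <= L * (d + d') * vol.
  move=> d0 d'0 sd tg sd' tg'; apply: (vriemann_sum_near sd tg sd' tg') => x y xD yD xy.
  by apply: fL => //; exact: addr_ge0.
pose t m (q : {ffun 'I_k -> 'I_m.+1}) := \row_i uniform_points a b m i (q i).
have us m := uniform_subdivision m ab.
have ut m : tags (uniform_points a b m) (t m).
  move=> q i; rewrite mxE lexx /=; have [_ _ /(_ _ (ltn_ord (q i)))] := us m i.
  by rewrite subr_ge0 => /andP[].
have mesh0 m : 0 <= uniform_mesh a b m by exact: uniform_mesh_ge0.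
pose c m := vriemann_sum (uniform_points a b m) (t m) f.
have cC : c \in cauchy_seqs Q.
  apply/asboolP => e e0.
  have e1 : 0 < e / (1 + L * vol) / 2.
    by rewrite !divr_gt0// ltr_pwDl// mulr_ge0.
  have [M HM] := uniform_mesh_small ab e1.
  exists M => i j Mi Mj; apply: le_lt_trans (near _ _ _ _ _ _ _ _ _ _ _ _ _ _) _.
  all: try exact: us; try exact: ut; try exact: mesh0.
  have h : uniform_mesh a b i + uniform_mesh a b j < e / (1 + L * vol).
    by rewrite [ltRHS](splitr _) ltrD// HM.
  rewrite mulrAC; apply: le_lt_trans (_ : (1 + L * vol) *
      (uniform_mesh a b i + uniform_mesh a b j) < e).
    by rewrite ler_wpM2r ?addr_ge0// lerDr.
  by rewrite mulrC -ltr_pdivlMr// ltr_pwDl// mulr_ge0.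
exists (completion_pi (CSeq cC)) => d N s t' d0 sd tg.
apply/ler_addgt0Pr => e e0.
have /cvgrPdist_le/(_ _ e0) [M1 _ HM1] := @cvg_completion_embed _ _ Q (CSeq cC).
have [M2 HM2] := uniform_mesh_small ab d0.
pose m := maxn M1 M2.
rewrite (le_trans (ler_distD (completion_embed Q (c m)) _ _))// addrC.
apply: lerD; last by apply: HM1; rewrite /= leq_maxl.
rewrite -raddfB/= norm_completion_embed.
apply: le_trans (near _ _ _ _ _ _ _ _ _ _ (us m) (ut m) sd tg) _ => //.
  exact: ltW.
rewrite ler_wpM2r// [2 * L]mulrC -mulrA ler_wpM2l// mulr2n mulrDl !mul1r.
by rewrite lerD2r ltW// HM2// leq_maxr.
Qed.

End RiemannLimit.

Section CellChains.
Context {R : realType} {n k : nat} (ip : {dot 'rV[R]_n for idfun}).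
Context (U : set 'rV[R]_n).
Implicit Types (o : 'rV[R]_n) (F : 'M[R]_(k, n)) (alpha : kvec R n k).

(** The constant depends on neither the base point of the frame nor the domain,
    so it survives when a cell shrinks to a point. *)
Lemma frame_dirac_lipschitz F alpha : exists2 L, 0 <= L &
  forall (C : set 'rV[R]_n) o (D : set 'rV[R]_k),
    @convex_set R 'rV[R]_n C -> C `<=` U -> frame_map o F @` D `<=` C ->
    lipschitz_on (Bnorm k ip U 1) D L (fun t => Defs.dirac U (frame_map o F t) alpha).
Proof.
have [K K0 HK] := ip_norm_bounded ip.
pose S := \sum_i \sum_j `|F i j|.
have S0 : 0 <= S by apply: sumr_ge0 => i _; exact: sumr_ge0.
exists (K * S * mass ip alpha); first by rewrite !mulr_ge0 ?mass_ge0 ?(ltW K0).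
move=> C o D cC CU DC x y w Dx Dy w0 xy.
apply: le_trans (Bnorm_dirac_sub _ _ cC CU _ _) _.
- by apply: DC; exists y.
- by apply: DC; exists x.
rewrite mulrAC ler_wpM2r ?mass_ge0// -mulrA; apply: HK; first exact: mulr_ge0.
move=> j; rewrite /frame_map opprD addrACA subrr add0r -mulmxBl mxE.
rewrite mulr_suml; apply: le_trans (ler_norm_sum _ _ _) _.
apply: ler_sum => i _; rewrite !mxE normrM mulrC ler_pM//.
by rewrite (bigD1 j)//= lerDl sumr_ge0.
Qed.

(** The limit of the Riemann sums of Dirac chains represents the cell: a form
    of class B^1 is Lipschitz for the B^1 norm, so its values on the sums, which
    are the Riemann sums of its density, converge to its value on the limit.
    The box of integration is the domain itself, so that no tag falls where the
    density is extended by 0. *)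
Lemma box_cell_chain o F (sigma : set 'rV[R]_n) (a b : 'rV[R]_k) (L : R) :
  let f := fun t => Defs.dirac U (frame_map o F t) (wedge F) in
  (forall i, a 0 i <= b 0 i) -> 0 <= L ->
  lipschitz_on (Bnorm k ip U 1) (in_box a b) L f ->
  frame_map o F @^-1` sigma = in_box a b ->
  exists2 J : differential_chain k ip U 1, cell_chain o F sigma J &
    forall d N s (t : {ffun 'I_k -> 'I_N} -> 'rV[R]_k),
      0 < d -> subdivision a b d N s -> tags s t ->
      `|J - completion_embed (Bnorm k ip U 1) (vriemann_sum s t f)|
        <= 2 * L * d * \prod_i (b 0 i - a 0 i).
Proof.
move=> f ab L0 fL sigmaE; have [J HJ] := vriemann_sum_limit ab L0 fL.
exists J => // omega /Bform_bounded[C0 C00 omegaC].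
exists a, b; split=> //; first by rewrite sigmaE.
set vol := \prod_i _ in HJ.
have vol0 : 0 <= vol by apply: prodr_ge0 => i _; rewrite subr_ge0.
move=> e e0; have c0 : 0 < 1 + C0 * (2 * L * vol) by rewrite ltr_pwDl// !mulr_ge0.
exists (e / (1 + C0 * (2 * L * vol))); first by rewrite divr_gt0.
set d := e / _; have d0 : 0 < d by rewrite divr_gt0.
move=> N s t sd tg.
have -> : riemann_sum s t (fun t => if t \in frame_map o F @^-1` sigma
    then omega (Defs.dirac U (frame_map o F t) (wedge F)) else 0)
    = omega (vriemann_sum s t f).
  rewrite linear_sum; apply: eq_bigr => m _; rewrite sigmaE.
  rewrite linearZ/= [RHS]mulrC mem_set// => i; have /andP[t1 t2] := tg m i.
  have /andP[am _] := subdivision_bounds i sd (ltnW (ltn_ord (m i))).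
  have /andP[_ bm] := subdivision_bounds i sd (ltn_ord (m i)).
  by rewrite (le_trans am t1) (le_trans t2 bm).
rewrite distrC; apply: le_lt_trans (completion_extend_lipschitz C00 _ J _) _.
  by move=> x y; rewrite -linearB; exact: omegaC.
apply: le_lt_trans (ler_wpM2l C00 (HJ _ _ _ _ d0 sd tg)) _.
rewrite (_ : C0 * _ = C0 * (2 * L * vol) * d); last by ring.
apply: lt_le_trans (_ : (1 + C0 * (2 * L * vol)) * d <= e).
  by rewrite ltr_pM2r// ltrDr.
by rewrite /d mulrC divfK// gt_eqF.
Qed.

End CellChains.

(** * Coordinate cubes are affine cells *)

Section Boxes.
Context {R : realType} {n : nat}.
Implicit Types (a b p : 'rV[R]_n).

Lemma in_box_convex a b : @convex_set R 'rV[R]_n (in_box a b).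
Proof.
move=> x y l; rewrite !inE => xab yab i.
rewrite [conv l x y](_ : _ = l%:num *: (x : 'rV[R]_n) + (1 - l%:num) *: (y : 'rV[R]_n))//.
have /andP[ax xb] := xab i; have /andP[ay yb] := yab i; rewrite !mxE.
have l0 : 0 <= l%:num by []; have l1 : l%:num <= 1 by [].
by apply/andP; split; nra.
Qed.

Lemma in_box_compact a b : compact (in_box a b).
Proof.
rewrite (_ : in_box a b = [set v | forall i, `[a 0 i, b 0 i]%classic (v ord0 i)]).
  by apply: (@rV_compact R n (fun i => `[a 0 i, b 0 i]%classic)) => i; exact: segment_compact.
by apply/seteqP; split => x /= h i; have := h i; rewrite /= in_itv.
Qed.

Lemma in_box_closure a b : closure (in_box a b) = in_box a b.
Proof.
have cl : closed (in_box a b).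
  by apply: compact_closed; [exact: norm_hausdorff | exact: in_box_compact].
by rewrite -((closure_id _).1 cl).
Qed.

Lemma open_in_box (U : set 'rV[R]_n) p : open U -> U p ->
  exists2 e, 0 < e & in_box (p - const_mx e) (p + const_mx e) `<=` U.
Proof.
move=> oU Up; have /nbhs_ballP[e /= e0 peU] : nbhs p U by exact: open_nbhs_nbhs.
exists (e / 2); first by rewrite divr_gt0.
move=> x px; apply: peU; split=> // i j; rewrite !ord1 -ball_normE/=.
have := px j; rewrite !mxE -ler_distlC => h.
by apply: le_lt_trans h _; rewrite ltr_pdivrMr// ltr_pMr// ltr1n.
Qed.

End Boxes.

Section CoordinateCells.
Context {R : realType} {n k : nat} (ip : {dot 'rV[R]_n for idfun}).
Context (U : set 'rV[R]_n).
Implicit Types (p : 'rV[R]_n) (I : multi_index n k) (t : 'rV[R]_k).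

Lemma mul_basis_frame t I i :
  (t *m basis_frame I) 0 (tnth (val I) i) = t 0 i.
Proof.
rewrite mxE (bigD1 i)//= big1 => [|j ji].
  by rewrite !mxE eqxx mulr1 addr0.
by rewrite !mxE (inj_eq (@multi_index_inj _ _ _)) (negPf ji) mulr0.
Qed.

Lemma mul_basis_frame_out t I j : j \notin val I -> (t *m basis_frame I) 0 j = 0.
Proof.
move=> jI; rewrite mxE big1// => i _; rewrite !mxE.
by case: eqP => [E|_]; rewrite ?mulr0//; rewrite -E mem_tnth in jI.
Qed.

Lemma row_free_basis_frame I : row_free (basis_frame I : 'M[R]_(k, n)).
Proof.
apply: inj_row_free => v vF; apply/rowP => i.
by rewrite -(mul_basis_frame v I) vF !mxE.
Qed.

Lemma frame_map_basis_in p I t i :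
  frame_map p (basis_frame I) t 0 (tnth (val I) i) = p 0 (tnth (val I) i) + t 0 i.
Proof. by rewrite mxE mul_basis_frame. Qed.

Lemma frame_map_basis_out p I t j : j \notin val I ->
  frame_map p (basis_frame I) t 0 j = p 0 j.
Proof. by move=> jI; rewrite mxE mul_basis_frame_out// addr0. Qed.

Definition coordinate_cube p I (e : R) : set 'rV[R]_n :=
  in_box p (frame_map p (basis_frame I) (const_mx e)).

Lemma coordinate_cube_coord p I e :
  frame_map p (basis_frame I) @^-1` coordinate_cube p I e = in_box 0 (const_mx e).
Proof.
apply/seteqP; split => t h i.
  have := h (tnth (val I) i); rewrite !frame_map_basis_in !mxE.
  by rewrite lerDl lerD2l.
have [/tnthP[j ->]|iI] := boolP (i \in val I); last first.
  by rewrite !frame_map_basis_out// lexx.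
by rewrite !frame_map_basis_in lerDl lerD2l; have := h j; rewrite !mxE.
Qed.

Lemma coordinate_cube_range p I e x : coordinate_cube p I e x ->
  x = frame_map p (basis_frame I) (\row_i (x - p) 0 (tnth (val I) i)).
Proof.
move=> h; apply/rowP => j; have [/tnthP[i ->]|jI] := boolP (j \in val I).
  by rewrite frame_map_basis_in !mxE addrCA subrr addr0.
have := h j; rewrite !frame_map_basis_out// => xj.
by apply/eqP; rewrite eq_le andbC.
Qed.

Lemma oriented_coordinate_cube p I e : coordinate_cube p I e `<=` U ->
  oriented_cell ip U p (basis_frame I) (coordinate_cube p I e).
Proof.
move=> sU; have [a aE] := ip_riesz ip; pose c i := tnth (val I) i.
pose F : 'M[R]_(k, n) := basis_frame I.
split; [exact: row_free_basis_frame | | | ]; rewrite /coordinate_cube ?in_box_closure//;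
  last exact: in_box_compact.
pose q := frame_map p F (const_mx e).
(* the Riesz vectors of the coordinates bound the cube by half spaces *)
pose hs := [seq (true, a (c i), q 0 (c i)) | i <- enum 'I_k] ++
           [seq (true, - a (c i), - p 0 (c i)) | i <- enum 'I_k].
have an0 i : a i != 0.
  apply/eqP => ai; have := aE i 'e_i; rewrite ai linear0l mxE !eqxx.
  by move/eqP; rewrite eq_sym oner_eq0.
have hsE x : (forall h, h \in hs -> half_space ip h x) <->
    forall i, p 0 (c i) <= x 0 (c i) <= q 0 (c i).
  split=> [h i|h].
    have /= := h (true, a (c i), q 0 (c i)); rewrite /half_space/= aE => ->.
      have /= := h (true, - a (c i), - p 0 (c i)).
      rewrite /half_space/= ipNl aE lerN2 => ->//.
      by rewrite mem_cat orbC map_f// mem_enum.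
    by rewrite mem_cat map_f// mem_enum.
  move=> g; rewrite mem_cat => /orP[] /mapP[i _ ->]; rewrite /half_space/=.
    by rewrite aE; have /andP[] := h i.
  by rewrite ipNl aE lerN2; have /andP[] := h i.
exists hs; split.
  by move=> g; rewrite mem_cat => /orP[] /mapP[i _ ->]; rewrite /= ?oppr_eq0.
apply/seteqP; split => [x h|_ [[t _ <-] /hsE h] j].
  split; last by apply/hsE => i; exact: h.
  by rewrite (coordinate_cube_range h); exists (\row_i (x - p) 0 (c i)).
have [/tnthP[i ->]|jI] := boolP (j \in val I); first exact: h.
by rewrite !frame_map_basis_out// lexx.
Qed.

End CoordinateCells.

(** * Approximating Dirac chains by polyhedral chains *)

Section Approximation.
Context {R : realType} {n k : nat} (ip : {dot 'rV[R]_n for idfun}).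
Context (U : set 'rV[R]_n) (openU : open U).
Implicit Types (p : 'rV[R]_n) (I : multi_index n k).
Implicit Types (x y : differential_chain k ip U 1).
Local Notation emb := (completion_embed (Bnorm k ip U 1)).

Definition approximable x := forall e, 0 < e ->
  exists2 P, polyhedral_chain k ip U P & `|x - P| <= e.

Lemma polyhedral_chain0 : polyhedral_chain k ip U 0.
Proof.
exists 0%N, (fun=> 0), (fun=> 0); split; first by case.
by rewrite big_ord0.
Qed.

Lemma polyhedral_chainZ c P :
  polyhedral_chain k ip U P -> polyhedral_chain k ip U (c *: P).
Proof.
move=> [m [a [J [HJ ->]]]]; exists m, (fun i => c * a i), J; split => //.
by rewrite scaler_sumr; apply: eq_bigr => i _; rewrite scalerA.
Qed.

Lemma polyhedral_chainD P P' : polyhedral_chain k ip U P ->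
  polyhedral_chain k ip U P' -> polyhedral_chain k ip U (P + P').
Proof.
move=> [m [a [J [HJ ->]]]] [m' [a' [J' [HJ' ->]]]].
pose f (T : Type) (g : 'I_m -> T) (g' : 'I_m' -> T) (i : 'I_(m + m')) :=
  match fintype.split i with inl j => g j | inr j => g' j end.
exists (m + m')%N, (f _ a a'), (f _ J J'); split.
  by move=> i; rewrite /f; case: fintype.split => j.
rewrite big_split_ord; congr (_ + _); apply: eq_bigr => i _; rewrite /f.
  by rewrite (unsplitK (inl _ i)).
by rewrite (unsplitK (inr _ i)).
Qed.

Lemma approximable0 : approximable 0.
Proof.
move=> e e0; exists 0; first exact: polyhedral_chain0.
by rewrite subrr normr0 ltW.
Qed.

Lemma approximableZ c x : approximable x -> approximable (c *: x).
Proof.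
move=> ax e e0; have c1 : 0 < 1 + `|c| by rewrite ltr_pwDl.
have [P pP xP] := ax (e / (1 + `|c|)) (divr_gt0 e0 c1).
exists (c *: P); first exact: polyhedral_chainZ.
rewrite -scalerBr normrZ; apply: le_trans (_ : (1 + `|c|) * `|x - P| <= _).
  by rewrite ler_wpM2r// lerDr.
by rewrite mulrC -ler_pdivlMr.
Qed.

Lemma approximableD x y : approximable x -> approximable y -> approximable (x + y).
Proof.
move=> ax ay e e0; have e2 : 0 < e / 2 by rewrite divr_gt0.
have [P pP xP] := ax _ e2; have [P' pP' yP'] := ay _ e2.
exists (P + P'); first exact: polyhedral_chainD.
by rewrite opprD addrACA (splitr e) (le_trans (ler_normD _ _))// lerD.
Qed.

Lemma approximable_sum (T : Type) (s : seq T) (F : T -> differential_chain k ip U 1) :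
  (forall i, approximable (F i)) -> approximable (\sum_(i <- s) F i).
Proof.
move=> aF; elim/big_ind: _ => //; [exact: approximable0 | exact: approximableD].
Qed.

(** A cube with corner [p], directions [I] and small edge [c] does it, once its
    chain is divided by [c ^+ k]: the bound [d] on [c] keeps the cube in a convex
    part of [U], and the other one makes the error [4 * L * c] at most [e]. *)
Lemma approximable_basis p I : U p ->
  approximable (emb (Defs.dirac U p (wedge (basis_frame I)))).
Proof.
move=> Up e e0; have [d d0 dU] := open_in_box openU Up.
pose F : 'M[R]_(k, n) := basis_frame I.
have [L L0 HL] := frame_dirac_lipschitz ip U F (wedge F).
have L1 : 0 < 1 + 4 * L by rewrite ltr_pwDl// mulr_ge0.
pose c := Num.min d (e / (1 + 4 * L)).
have c0 : 0 < c by rewrite lt_min d0 divr_gt0.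
have cd : c <= d by rewrite ge_min lexx.
have cL : 4 * L * c <= e.
  apply: le_trans (_ : (1 + 4 * L) * c <= _).
    by rewrite ler_wpM2r ?(ltW c0)// lerDr.
  by rewrite mulrC -ler_pdivlMr// ge_min lexx orbT.
have cubeU : coordinate_cube p I c `<=` in_box (p - const_mx d) (p + const_mx d).
  move=> x h j; have /andP[px xq] := h j; rewrite !mxE.
  apply/andP; split; first by apply: le_trans px; rewrite gerBl ltW.
  apply: le_trans xq _; have [/tnthP[i ->]|jI] := boolP (j \in val I).
    by rewrite frame_map_basis_in mxE lerD2l.
  by rewrite frame_map_basis_out// lerDl ltW.
have ab i : (0 : 'rV[R]_k) 0 i <= (const_mx c : 'rV[R]_k) 0 i by rewrite !mxE ltW.
have lip := HL _ p (in_box 0 (const_mx c)) (@in_box_convex _ _ _ _) dU.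
have [|J cellJ HJ] := box_cell_chain ab L0 (lip _) (coordinate_cube_coord p I c).
  move=> _ [t tc <-]; apply: cubeU.
  by have : (frame_map p F @^-1` coordinate_cube p I c) t by rewrite coordinate_cube_coord.
exists ((c ^+ k)^-1 *: J).
  exists 1%N, (fun=> (c ^+ k)^-1), (fun=> J); split; last by rewrite big_ord1.
  move=> _; exists p, F, (coordinate_cube p I c); split => //.
  by apply: oriented_coordinate_cube; exact: subset_trans dU.
(* the subdivision into a single box, tagged at p, shows that J is close to the
   Dirac chain of p weighted by the volume of the cube *)
pose s (i : 'I_k) (j : nat) : R := if j is 0 then 0 else c.
have c2 : 0 < 2 * c by rewrite mulr_gt0.
have sd : subdivision 0 (const_mx c) (2 * c) 1 s.
  move=> i; rewrite !mxE; split => // -[|//] _ /=.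
  by rewrite subr0 (ltW c0) /= ltr_pMl// ltr1n.
have tg : tags s (fun _ : {ffun 'I_k -> 'I_1} => 0).
  by move=> m i; rewrite !mxE ord1 /= lexx ltW.
have := HJ _ _ _ _ c2 sd tg.
have volE : \prod_i ((const_mx c : 'rV[R]_k) 0 i - (0 : 'rV[R]_k) 0 i) = c ^+ k.
  rewrite (eq_bigr (fun=> c)) ?prodr_const ?card_ord// => i _.
  by rewrite !mxE subr0.
rewrite volE (_ : vriemann_sum s (fun _ : {ffun 'I_k -> 'I_1} => 0)
    (fun t => Defs.dirac U (frame_map p F t) (wedge F))
    = c ^+ k *: Defs.dirac U p (wedge F)); last first.
  rewrite /vriemann_sum /frame_map mul0mx addr0 -scaler_suml.
  by rewrite (cell_volume_sum sd) volE.
have ck : 0 < c ^+ k by rewrite exprn_gt0.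
move=> HJc.
rewrite -[emb _](scalerK (lt0r_neq0 ck)) -scalerBr normrZ ger0_norm ?invr_ge0 ?(ltW ck)//.
rewrite mulrC ler_pdivrMr// -linearZ distrC; apply: le_trans HJc _.
rewrite ler_wpM2r ?(ltW ck)//; apply: le_trans cL.
by rewrite le_eqVlt; apply/orP; left; apply/eqP; ring.
Qed.

Lemma dirac_basis p (alpha : kvec R n k) : U p ->
  Defs.dirac U p alpha
    = \sum_(I <- index_enum (multi_index n k))
        alpha I *: Defs.dirac U p (wedge (basis_frame I)).
Proof.
move=> Up; apply: val_inj; rewrite val_dirac_sum val_dirac//.
apply/funext => q; rewrite fct_sumE.
rewrite (eq_bigr (fun J => if q == p then alpha J *: wedge (basis_frame J) else 0)).
  rewrite /point_chain; have [_|qp] := eqVneq q p; last by rewrite big1.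
  exact: kvec_basis.
move=> J _; transitivity (alpha J *: val (Defs.dirac U p (wedge (basis_frame J))) q) => //.
by rewrite val_dirac// /point_chain; case: eqP; rewrite ?scaler0.
Qed.

Lemma approximable_dirac_chain (A : dirac_chain k U) : approximable (emb A).
Proof.
have [s sU ->] := dirac_chain_decomp A; rewrite linear_sum big_seq.
elim/big_ind: _ => [|x y|p ps]; [exact: approximable0 | exact: approximableD |].
rewrite dirac_basis ?linear_sum; last exact: sU.
apply: approximable_sum => J; rewrite linearZ; apply: approximableZ.
by apply: approximable_basis; exact: sU.
Qed.

End Approximation.

Theorem theorem4p2p5 (R : realType) (n k r : nat)
    (ip : {dot 'rV[R]_n for idfun}) (U : set 'rV[R]_n)
    (openU : open U) (kn : (k <= n)%N) (r1 : (1 <= r)%N) :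
  dense (linking_map r @` polyhedral_chain k ip U
         : set (differential_chain k ip U r)).
Proof.
move=> O O0 oO; have [x [Ox [A _ Ax]]] := dense_completion_embed O0 oO.
have /nbhs_ballP[e /= e0 AeO] :
    nbhs (completion_embed (Bnorm k ip U r) A) O by rewrite Ax; exact: open_nbhs_nbhs.
have e2 : 0 < e / 2 by rewrite divr_gt0.
have [P pP AP] := approximable_dirac_chain ip openU A e2.
exists (linking_map r P); split; last by exists P.
apply: AeO; rewrite -ball_normE/= distrC.
have emb_lip (X Y : dirac_chain k U) :
    `|completion_embed (Bnorm k ip U r) X - completion_embed (Bnorm k ip U r) Y|
      <= 1 * Bnorm k ip U 1 (X - Y).
  by rewrite -raddfB/= norm_completion_embed mul1r; exact: Bnorm_antitone.
apply: le_lt_trans (completion_extend_lipschitz ler01 emb_lip P A) _.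
rewrite mul1r distrC; apply: le_lt_trans AP _.
by rewrite ltr_pdivrMr// ltr_pMr// ltr1n.
Qed.
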